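(* The index set of computable decomposable torsion-free abelian groups of finite rank, i.e. the set of all $e \in \omega$ such that $e$ is a computable index of a torsion-free abelian group which has finite rank and is decomposable, is $\Sigma^0_3$-complete.
   Context: A group is computable if its domain can be effectively enumerated and its binary operation is computable via the enumeration; concretely, one takes computable groups with domain $\omega$ and says that $e$ is a computable index of a group if the $e$-th partial computable function $\varphi_e:\omega\times\omega\to\omega$ is total and is the operation of a group on $\omega$. The trivial group is not decomposable, so restricting to infinite domain loses no decomposable torsion-free groups. A basis of a torsion-free abelian group is a maximal linearly independent subset, and the rank of the group is the cardinality of any basis. An abelian group is decomposable if it can be written as the direct sum of two (or more) nontrivial subgroups; otherwise it is indecomposable. A set $A\subseteq\omega$ is $\Gamma$-complete, for a complexity class $\Gamma$, if $A\in\Gamma$ and for every $B\in\Gamma$, $B \subseteq \omega$, there is a computable function $f:\omega\to\omega$ such that $x\in B$ if and only if $f(x)\in A$. A set is $\Sigma^0_3$ if it is definable in the form $\exists y_1\forall y_2\exists y_3\,R(x,y_1,y_2,y_3)$ with quantifiers over $\omega$ and $R$ computable. *)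

(* Defs.v *)
From HB Require Import structures.
From Stdlib Require Cantor.
From mathcomp Require Import all_boot all_order all_algebra zify.

Set Implicit Arguments.
Unset Strict Implicit.
Unset Printing Implicit Defensive.

Import GRing.Theory.

Local Open Scope nat_scope.

(* Partial computable functions.  Programs denote partial unary functions on  *)
(* nat; several arguments are passed through the Cantor pairing bijection.    *)

Definition pair_code (x y : nat) : nat := Cantor.to_nat (x, y).

Inductive code : Type :=
  | CZero | CSucc | CLeft | CRight
  | CPair of code & code
  | CComp of code & code
  | CPrec of code & code
  | CMin of code.

(* [eval c x y]: the computation of [c] on input [x] halts with output [y].   *)
(* In [CMin c], all values of [c] below the least zero must be defined.       *)
Fixpoint eval (c : code) (x y : nat) : Prop :=
  match c with
  | CZero => y = 0
  | CSucc => y = x.+1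
  | CLeft => y = (Cantor.of_nat x).1
  | CRight => y = (Cantor.of_nat x).2
  | CPair c1 c2 => exists a b, [/\ eval c1 x a, eval c2 x b & y = pair_code a b]
  | CComp c1 c2 => exists2 a, eval c2 x a & eval c1 a y
  | CPrec c1 c2 => let (a, n) := Cantor.of_nat x in
      exists h : nat -> nat,
        [/\ eval c1 a (h 0),
            forall i, i < n -> eval c2 (pair_code a (pair_code i (h i))) (h i.+1) &
            y = h n]
  | CMin c1 =>
      eval c1 (pair_code x y) 0 /\
      forall i, i < y -> exists m, eval c1 (pair_code x i) m.+1
  end.

Fixpoint encode (c : code) : nat :=
  match c with
  | CZero => 0
  | CSucc => 1
  | CLeft => 2
  | CRight => 3
  | CPair c1 c2 => 4 * pair_code (encode c1) (encode c2) + 4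
  | CComp c1 c2 => 4 * pair_code (encode c1) (encode c2) + 5
  | CPrec c1 c2 => 4 * pair_code (encode c1) (encode c2) + 6
  | CMin c1 => 4 * encode c1 + 7
  end.

(* Graphs of the e-th partial computable functions of one and two variables.  *)
Definition phi (e x y : nat) : Prop := exists2 c, encode c = e & eval c x y.

Definition phi2 (e x y z : nat) : Prop := phi e (pair_code x y) z.

Definition computable (f : nat -> nat) : Prop :=
  exists e, forall x, phi e x (f x).

Definition computable_rel4 (R : nat -> nat -> nat -> nat -> bool) : Prop :=
  exists e, forall x y1 y2 y3,
    phi e (pair_code x (pair_code y1 (pair_code y2 y3)))
      (nat_of_bool (R x y1 y2 y3)).

Definition Sigma03 (A : nat -> Prop) : Prop :=
  exists2 R : nat -> nat -> nat -> nat -> bool, computable_rel4 R &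
    forall x, A x <-> exists y1, forall y2, exists y3, R x y1 y2 y3.

Definition complete (Gamma : (nat -> Prop) -> Prop) (A : nat -> Prop) : Prop :=
  Gamma A /\
  forall B : nat -> Prop, Gamma B ->
    exists2 f : nat -> nat, computable f & forall x, B x <-> A (f x).

Lemma pair_code_inj (a b a' b' : nat) :
  pair_code a b = pair_code a' b' -> a = a' /\ b = b'.
Proof. by move/Cantor.to_nat_inj => -[]. Qed.

Lemma encode_inj : injective encode.
Proof.
elim=> [||||c1 I1 c2 I2|c1 I1 c2 I2|c1 I1 c2 I2|c1 I1]
       [||||d1 d2|d1 d2|d1 d2|d1] //= h; try by lia.
all: try have /pair_code_inj[/I1 -> /I2 ->] //:
  pair_code (encode c1) (encode c2) = pair_code (encode d1) (encode d2) by lia.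
by congr CMin; apply: I1; lia.
Qed.

Lemma eval_det (c : code) (x y z : nat) : eval c x y -> eval c x z -> y = z.
Proof.
elim: c x y z => [||||c1 I1 c2 I2|c1 I1 c2 I2|c1 I1 c2 I2|c1 I1] x y z /=;
  try by move=> -> ->.
- move=> [a [b [xa xb ->]]] [a' [b' [xa' xb' ->]]].
  by rewrite (I1 _ _ _ xa xa') (I2 _ _ _ xb xb').
- by move=> [a xa ay] [a' /(I2 _ _ _ xa) <-]; apply: I1.
- case: (Cantor.of_nat x) => a n [h [h0 hS ->]] [g [g0 gS ->]].
  suff: forall i, i <= n -> h i = g i by apply.
  elim=> [_|i IHi lt_in]; first exact: I1 h0 g0.
  by have := gS i lt_in; rewrite -IHi ?(ltnW lt_in) //; apply: I2; apply: hS.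
- move=> [y0 ylt] [z0 zlt]; case: (ltngtP y z) => // [lt_yz|lt_zy].
    by have [m /(I1 _ _ _ y0)] := zlt y lt_yz.
  by have [m /(I1 _ _ _ z0)] := ylt z lt_zy.
Qed.

(* Abelian group structures with domain nat, written additively.              *)

Record nat_abgroup : Type := NatAbGroup {
  nat_add : nat -> nat -> nat;
  nat_zero : nat;
  nat_opp : nat -> nat;
  nat_addA : associative nat_add;
  nat_addC : commutative nat_add;
  nat_add0 : left_id nat_zero nat_add;
  nat_addN : left_inverse nat_zero nat_opp nat_add
}.

Definition domain (G : nat_abgroup) : Type := nat.

HB.instance Definition _ (G : nat_abgroup) := Countable.copy (domain G) nat.
HB.instance Definition _ (G : nat_abgroup) :=
  GRing.isZmodule.Build (domain G)
    (@nat_addA G) (@nat_addC G) (@nat_add0 G) (@nat_addN G).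

(* Totality of phi_e is part of this, since [nat_add G] is total.             *)
Definition computable_index (e : nat) (G : nat_abgroup) : Prop :=
  forall x y, phi2 e x y (nat_add G x y).

Section AbelianGroups.

Local Open Scope ring_scope.

Variable V : zmodType.

Definition torsion_free : Prop :=
  forall (x : V) (n : nat), (0 < n)%N -> x *+ n = 0 -> x = 0.

Definition linearly_independent (B : V -> Prop) : Prop :=
  forall (s : seq V) (c : V -> int),
    uniq s -> (forall x, x \in s -> B x) ->
    \sum_(x <- s) x *~ c x = 0 -> forall x, x \in s -> c x = 0.

Definition is_basis (B : V -> Prop) : Prop :=
  linearly_independent B /\
  forall B' : V -> Prop, linearly_independent B' ->
    (forall x, B x -> B' x) -> forall x, B' x -> B x.

Definition finite_rank : Prop := exists s : seq V, is_basis (fun x => x \in s).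

Definition is_subgroup (H : V -> Prop) : Prop :=
  H 0 /\ forall x y, H x -> H y -> H (x - y).

Definition nontrivial (H : V -> Prop) : Prop := exists2 x, H x & x <> 0.

Definition direct_sum (H K : V -> Prop) : Prop :=
  (forall x, exists a b, [/\ H a, K b & x = a + b]) /\
  (forall x, H x -> K x -> x = 0).

Definition decomposable : Prop :=
  exists H K : V -> Prop,
    [/\ is_subgroup H /\ nontrivial H, is_subgroup K /\ nontrivial K &
        direct_sum H K].

End AbelianGroups.

(* Main.v *)
From HB Require Import structures.
Require Import Defs.
From Stdlib Require Import Classical ClassicalEpsilon FunctionalExtensionality.
From Stdlib Require Cantor.
From mathcomp Require Import all_boot all_order all_algebra zify.

Set Implicit Arguments.
Unset Strict Implicit.
Unset Printing Implicit Defensive.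

Local Open Scope nat_scope.

(** Membership in Sigma-3. A torsion-free abelian group of finite rank splits
    exactly when there are finite lists h and k, both with a nonzero entry, such
    that the pure subgroups generated by h and by k (the elements some positive
    multiple of which is an integer combination of the list) meet trivially and
    add up to the group: one obtains h and k by projecting a basis to the two
    summands, [direct_sum_pure], and conversely h ++ k contains a basis,
    [pure_finite_rank]. Once h and k are fixed, what remains to be said is of the
    form for all - there is: membership in a pure subgroup is semidecidable, and
    since a total operation gives every relation between the entries a definite
    truth value, a failing relation is also recognized by computing its two sides.
    This is [split_tfgroupP] together with [pi2_split_tfgroup]. It relies on a
    normal form for partial computable functions, [phiP]: a computation is
    certified by a finite list of facts, program e maps x to y, each of which
    follows from later entries of the list by one evaluation rule.

    Hardness. It is enough to build, uniformly in x, a torsion-free group that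
    always splits and whose rank is finite exactly when x belongs to the given
    Sigma-3 set. Write the set as the x for which some n has for all y
    a witness z. Stage s = (n, u) of the construction
    carries the mark n if the number of initial y which have a witness for n below
    the bound u grows when the bound passes from u to u + 1, and the mark s
    otherwise. Some mark is carried infinitely often if and only if x belongs to
    the set. The group is generated by a_0, a_1, a_2, ..., where a_i, for i > 1, is
    killed at the first stage t > i whose mark is at most the mark of i, and
    otherwise stays independent of the others. Generators that live forever have
    marks below all later marks, so there are finitely many of them exactly when
    the marks have a finite inferior limit, [outbid_cofinite].

    Killing must keep the group torsion-free and its equality decidable although
    it is never known whether a generator will be killed later. A generator killed
    at stage t is therefore identified with E! times a_1, where E exceeds the code
    of (i, t). In an equality between sums of at most S generators in total,
    factorials of distinct numbers that are at least S cannot cancel,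
    [factorial_sum_count]. So whatever happens to a generator at stage S or later,
    its multiplicities on both sides have to agree, and equality is decided by
    pretending that all generators alive at stage S are killed at that stage,
    [sameP]. The group is realized inside the integer polynomials, a living a_i
    being X^i and a_1 being X; it splits because a_0 is never killed,
    [killed_group_decomposable], and it has finite rank if and only if almost all
    generators die, [killed_group_finite_rank]. Enumerating the least names of its
    elements turns it into a group on the natural numbers, uniformly computable in
    x, [calc_gadd]. *)

(** * Computable functions between coded types *)

Lemma pair_code_ge (x y : nat) : x + y <= pair_code x y.
Proof. by rewrite addnC; apply/leP; apply: Cantor.to_nat_non_decreasing. Qed.

Lemma pair_codeK (x y : nat) : Cantor.of_nat (pair_code x y) = (x, y).
Proof. exact: Cantor.cancel_of_to. Qed.

Class coded (T : Type) := Coded { enc : T -> nat; enc_inj : injective enc }.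

#[export] Instance coded_nat : coded nat := @Coded nat id (@inj_id nat).

Lemma nat_of_bool_inj : injective nat_of_bool.
Proof. by case; case. Qed.

#[export] Instance coded_bool : coded bool := Coded nat_of_bool_inj.

Lemma enc_pair_inj (A B : Type) (cA : coded A) (cB : coded B) :
  injective (fun p : A * B => pair_code (enc p.1) (enc p.2)).
Proof.
by case=> a b [c d] /= /pair_code_inj[/(@enc_inj A cA) -> /(@enc_inj B cB) ->].
Qed.

#[export] Instance coded_pair A B {cA : coded A} {cB : coded B} :
  coded (A * B) := Coded (@enc_pair_inj A B cA cB).

Definition enc_seq (T : Type) (cT : coded T) (s : seq T) : nat :=
  foldr (fun x n => (pair_code (enc x) n).+1) 0 s.

Lemma enc_seq_inj (T : Type) (cT : coded T) : injective (@enc_seq T cT).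
Proof.
elim=> [|x s IHs] [|y t] //= e.
by have /pair_code_inj[/(@enc_inj T cT) -> /IHs ->] := succn_inj e.
Qed.

#[export] Instance coded_seq T {cT : coded T} : coded (seq T) :=
  Coded (@enc_seq_inj T cT).

(** Types all of whose numbers are codes: quantifiers over them can be traded for
    quantifiers over numbers. *)
Class decoded (T : Type) {cT : coded T} :=
  Decoded { dec : nat -> T; decK : cancel dec enc }.

Arguments decoded T {cT}.
Arguments Decoded T {cT}.
Arguments dec {T cT decoded}.

#[export] Instance decoded_nat : decoded nat.
Proof. by exists id. Defined.

#[export] Instance decoded_pair A B {cA : coded A} {cB : coded B}
  {dA : decoded A} {dB : decoded B} : decoded (A * B).
Proof.
exists (fun n => (dec (Cantor.of_nat n).1, dec (Cantor.of_nat n).2)) => n.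
rewrite /= !decK /pair_code -surjective_pairing.
exact: Cantor.cancel_to_of.
Defined.

(** The fuel [k] makes the recursion structural; a list is no longer than its
    code, so [k := n] suffices. *)
Fixpoint dec_seq_rec (T : Type) (cT : coded T) (dT : decoded T) (k n : nat) :
  seq T :=
  if k is k'.+1 then
    if n is n'.+1 then
      dec (Cantor.of_nat n').1 :: dec_seq_rec dT k' (Cantor.of_nat n').2
    else [::]
  else [::].

Lemma dec_seq_recK (T : Type) (cT : coded T) (dT : decoded T) (k n : nat) :
  n <= k -> enc (dec_seq_rec dT k n) = n.
Proof.
elim: k n => [|k IHk] [|m] //= le_mk.
rewrite decK; case def_m: (Cantor.of_nat m) => [a b] /=.
have e_m : m = pair_code a b by rewrite -[m]Cantor.cancel_to_of def_m.
rewrite [enc_seq _ _]IHk ?e_m //.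
by have := pair_code_ge a b; lia.
Qed.

#[export] Instance decoded_seq T {cT : coded T} {dT : decoded T} :
  decoded (seq T).
Proof.
by exists (fun n => dec_seq_rec dT n n) => n; apply: dec_seq_recK.
Defined.

Lemma encK (T : Type) (cT : coded T) (dT : decoded T) (x : T) :
  dec (enc x) = x.
Proof. by apply: enc_inj; rewrite decK. Qed.

(** Computability of a function through the codes of its argument and value;
    behaviour on numbers that are not codes is left open. *)
Definition calc (A B : Type) {cA : coded A} {cB : coded B} (f : A -> B) : Prop :=
  exists c, forall a, eval c (enc a) (enc (f a)).

Lemma calc_ext {A B : Type} {cA : coded A} {cB : coded B}
  (f g : A -> B) : f =1 g -> calc f -> calc g.
Proof. by move=> eq_fg [c c_f]; exists c => a; rewrite -eq_fg. Qed.

Lemma calc_id {A : Type} {cA : coded A}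
  : calc (fun a : A => a).
Proof.
exists (CPair CLeft CRight) => a /=.
exists (Cantor.of_nat (enc a)).1, (Cantor.of_nat (enc a)).2; split=> //.
by rewrite /pair_code -surjective_pairing Cantor.cancel_to_of.
Qed.

Lemma calc_comp {A B C : Type} {cA : coded A} {cB : coded B} {cC : coded C}
  (g : B -> C) (f : A -> B) :
  calc g -> calc f -> calc (fun a => g (f a)).
Proof. by move=> [c g_c] [d f_d]; exists (CComp c d) => a; exists (enc (f a)). Qed.

Lemma calc_pair {A B C : Type} {cA : coded A} {cB : coded B} {cC : coded C}
  (f : A -> B) (g : A -> C) :
  calc f -> calc g -> calc (fun a => (f a, g a)).
Proof.
by move=> [c f_c] [d g_d]; exists (CPair c d) => a /=; exists (enc (f a)), (enc (g a)).
Qed.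

Lemma calc_fst {A B C : Type} {cA : coded A} {cB : coded B} {cC : coded C}
  (f : A -> B * C) : calc f -> calc (fun a => (f a).1).
Proof.
move=> [c f_c]; exists (CComp CLeft c) => a; exists (enc (f a)) => //=.
by rewrite Cantor.cancel_of_to.
Qed.

Lemma calc_snd {A B C : Type} {cA : coded A} {cB : coded B} {cC : coded C}
  (f : A -> B * C) : calc f -> calc (fun a => (f a).2).
Proof.
move=> [c f_c]; exists (CComp CRight c) => a; exists (enc (f a)) => //=.
by rewrite Cantor.cancel_of_to.
Qed.

(** Only the input and output numbers matter, so a function that does not move
    codes is computed by the identity program. *)
Lemma calc_enc {A B C : Type} {cA : coded A} {cB : coded B} {cC : coded C}
  (g : B -> C) (f : A -> B) :
  (forall b, enc (g b) = enc b) -> calc f -> calc (fun a => g (f a)).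
Proof. by move=> eg [c f_c]; exists c => a; rewrite eg. Qed.

Lemma calc_succ {A : Type} {cA : coded A}
  (f : A -> nat) : calc f -> calc (fun a => (f a).+1).
Proof. by move=> [c f_c]; exists (CComp CSucc c) => a; exists (f a). Qed.

Lemma calc_const {A B : Type} {cA : coded A} {cB : coded B}
  (b : B) : calc (fun _ : A => b).
Proof.
have [c c_b] : exists c, forall x, eval c x (enc b); last by exists c => a; apply: c_b.
elim: (enc b) => [|n [c c_n]]; first by exists CZero.
by exists (CComp CSucc c) => x; exists n.
Qed.

Lemma calc_iteri {A B : Type} {cA : coded A} {cB : coded B}
  (n : A -> nat) (g : A -> nat -> B -> B) (f : A -> B) :
  calc n -> calc (fun q : A * (nat * B) => g q.1 q.2.1 q.2.2) -> calc f ->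
  calc (fun a => iteri (n a) (g a) (f a)).
Proof.
move=> [cn n_c] [cg g_c] [cf f_c].
exists (CComp (CPrec cf cg) (CPair (CPair CLeft CRight) cn)) => a.
exists (pair_code (enc a) (n a)).
  exists (enc a), (n a); split=> //=.
  exists (Cantor.of_nat (enc a)).1, (Cantor.of_nat (enc a)).2; split=> //.
  by rewrite /pair_code -surjective_pairing Cantor.cancel_to_of.
rewrite /= Cantor.cancel_of_to; exists (fun i => enc (iteri i (g a) (f a))).
by split=> // i lt_i; have := g_c (a, (i, iteri i (g a) (f a))).
Qed.

Lemma calc_app2 {A B C D : Type} {cA : coded A} {cB : coded B}
  {cC : coded C} {cD : coded D}
  (F : B -> C -> D) (f : A -> B) (g : A -> C) :
  calc (fun p : B * C => F p.1 p.2) -> calc f -> calc g ->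
  calc (fun a => F (f a) (g a)).
Proof. by move=> cF cf cg; exact: calc_comp cF (calc_pair cf cg). Qed.

Lemma calc_app3 {A B C D E : Type} {cA : coded A} {cB : coded B} {cC : coded C}
  {cD : coded D} {cE : coded E} (F : B -> C -> D -> E)
  (f : A -> B) (g : A -> C) (h : A -> D) :
  calc (fun p : B * (C * D) => F p.1 p.2.1 p.2.2) ->
  calc f -> calc g -> calc h -> calc (fun a => F (f a) (g a) (h a)).
Proof.
by move=> cF cf cg ch; exact: calc_comp cF (calc_pair cf (calc_pair cg ch)).
Qed.

Lemma calc_encode {A B : Type} {cA : coded A} {cB : coded B}
  (f : A -> B) : calc f -> calc (fun a => enc (f a)).
Proof. exact: calc_enc. Qed.

Lemma calc_dec {A B : Type} {cA : coded A} {cB : coded B}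
  {dB : decoded B} (f : A -> nat) :
  calc f -> calc (fun a => dec (f a) : B).
Proof. by apply: calc_enc => n; rewrite decK. Qed.

Lemma calc_pair_code {A : Type} {cA : coded A}
  (f g : A -> nat) :
  calc f -> calc g -> calc (fun a => pair_code (f a) (g a)).
Proof.
move=> cf cg.
apply: (calc_enc (g := fun p : nat * nat => pair_code p.1 p.2)
                 (f := fun a => (f a, g a))) => //.
exact: calc_pair.
Qed.

Lemma calc_unpair {A : Type} {cA : coded A}
  (f : A -> nat) : calc f -> calc (fun a => Cantor.of_nat (f a)).
Proof.
apply: (calc_enc (g := Cantor.of_nat)) => n.
by rewrite /= /pair_code -surjective_pairing Cantor.cancel_to_of.
Qed.

Lemma calc_pred {A : Type} {cA : coded A}
  (f : A -> nat) : calc f -> calc (fun a => (f a).-1).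
Proof.
move=> cf; apply: calc_ext (calc_iteri (g := fun _ i _ => i) cf _ (calc_const 0)).
  by move=> a; case: (f a).
exact: calc_fst (calc_snd calc_id).
Qed.

Lemma calc_addn {A : Type} {cA : coded A}
  (f g : A -> nat) : calc f -> calc g -> calc (fun a => f a + g a).
Proof.
move=> cf cg; apply: calc_ext (calc_iteri (g := fun _ _ r => r.+1) cf _ cg).
  by move=> a; elim: (f a) => //= n ->.
exact: calc_succ (calc_snd (calc_snd calc_id)).
Qed.

Lemma calc_muln {A : Type} {cA : coded A}
  (f g : A -> nat) : calc f -> calc g -> calc (fun a => f a * g a).
Proof.
move=> cf cg.
apply: calc_ext (calc_iteri (g := fun a _ r => g a + r) cf _ (calc_const 0)).
  by move=> a; elim: (f a) => //= n ->; rewrite mulSn.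
apply: calc_addn; first exact: calc_comp cg (calc_fst calc_id).
exact: calc_snd (calc_snd calc_id).
Qed.

Lemma calc_subn {A : Type} {cA : coded A}
  (f g : A -> nat) : calc f -> calc g -> calc (fun a => f a - g a).
Proof.
move=> cf cg; apply: calc_ext (calc_iteri (g := fun _ _ r => r.-1) cg _ cf).
  by move=> a; elim: (g a) => /= [|n ->]; lia.
exact: calc_pred (calc_snd (calc_snd calc_id)).
Qed.

Lemma calc_factorial {A : Type} {cA : coded A}
  (f : A -> nat) : calc f -> calc (fun a => (f a)`!).
Proof.
move=> cf.
apply: calc_ext (calc_iteri (g := fun _ i r => i.+1 * r) cf _ (calc_const 1)).
  by move=> a; elim: (f a) => //= n ->; rewrite factS.
apply: calc_muln; first exact: calc_succ (calc_fst (calc_snd calc_id)).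
exact: calc_snd (calc_snd calc_id).
Qed.

Lemma calc_if {A B : Type} {cA : coded A} {cB : coded B}
  (b : A -> bool) (f g : A -> B) :
  calc b -> calc f -> calc g -> calc (fun a => if b a then f a else g a).
Proof.
move=> cb cf cg.
have cb' : calc (fun a => nat_of_bool (b a)) by exact: calc_enc cb.
apply: calc_ext (calc_iteri (g := fun a _ _ => f a) cb' _ cg).
  by move=> a; case: (b a).
exact: calc_comp cf (calc_fst calc_id).
Qed.

Lemma calc_nat_of_bool {A : Type} {cA : coded A}
  (b : A -> bool) : calc b -> calc (fun a => nat_of_bool (b a)).
Proof. exact: calc_enc. Qed.

Lemma calc_negb {A : Type} {cA : coded A}
  (b : A -> bool) : calc b -> calc (fun a => ~~ b a).
Proof.
move=> cb; apply: calc_ext (calc_if cb (calc_const false) (calc_const true)).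
by move=> a; case: (b a).
Qed.

Lemma calc_andb {A : Type} {cA : coded A}
  (b c : A -> bool) : calc b -> calc c -> calc (fun a => b a && c a).
Proof. by move=> cb cc; apply: calc_ext (calc_if cb cc (calc_const false)). Qed.

Lemma calc_orb {A : Type} {cA : coded A}
  (b c : A -> bool) : calc b -> calc c -> calc (fun a => b a || c a).
Proof. by move=> cb cc; apply: calc_ext (calc_if cb (calc_const true) cc). Qed.

Lemma calc_leq {A : Type} {cA : coded A}
  (f g : A -> nat) : calc f -> calc g -> calc (fun a => f a <= g a).
Proof.
move=> cf cg.
have cs := calc_subn cf cg.
apply: calc_ext (calc_iteri (g := fun _ _ _ => false) cs _ (calc_const true)).
  by move=> a; rewrite /leq; case: (f a - g a).
exact: calc_const.
Qed.

Lemma calc_eq {A : Type} {cA : coded A}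
  {T : eqType} {cT : coded T} (f g : A -> T) :
  calc f -> calc g -> calc (fun a => f a == g a).
Proof.
move=> /calc_encode cf /calc_encode cg.
apply: calc_ext (calc_andb (calc_leq cf cg) (calc_leq cg cf)) => a.
by rewrite -eqn_leq (inj_eq (@enc_inj T cT)).
Qed.

(** Branching on the sign of the code first keeps the second branch from being
    run on a number that is not the code of a cell. *)
Lemma calc_case {A B C : Type} {cA : coded A} {cB : coded B} {cC : coded C}
  (s : A -> seq C) (z : A -> B) (g : A -> C -> seq C -> B) :
  calc s -> calc z -> calc (fun q : A * (C * seq C) => g q.1 q.2.1 q.2.2) ->
  calc (fun a => if s a is x :: r then g a x r else z a).
Proof.
move=> [cs s_c] [cz z_c] [cg g_c].
have [cp p_c] : calc (fun n : nat => n.-1) by exact: calc_pred calc_id.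
have [ct t_c] : calc (fun n : nat => nat_of_bool (0 < n)).
  by apply/calc_nat_of_bool/calc_leq; [exact: calc_const | exact: calc_id].
have [ci i_c] : calc (fun a : A => a) by exact: calc_id.
exists (CComp (CPrec (CComp cz CLeft)
          (CComp cg (CPair (CComp CLeft CLeft) (CComp cp (CComp CRight CLeft)))))
        (CPair (CPair ci cs) (CComp ct cs))) => a.
exists (pair_code (pair_code (enc a) (enc (s a))) (nat_of_bool (0 < enc (s a)))).
  exists (pair_code (enc a) (enc (s a))), (nat_of_bool (0 < enc (s a))).
  split=> //; first by exists (enc a), (enc (s a)).
  by exists (enc (s a)); [apply: s_c | apply: t_c].
rewrite /= Cantor.cancel_of_to.
exists (fun i => if i is _.+1 then enc (if s a is x :: r then g a x r else z a)
                 else enc (z a)); split.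
- by exists (enc a); rewrite /= ?Cantor.cancel_of_to.
- case=> [|i]; last by case: (0 < _).
  case def_s: (s a) => [|x r] //= _.
  exists (pair_code (enc a) (pair_code (enc x) (enc_seq cC r)));
    last exact: (g_c (a, (x, r))).
  exists (enc a), (pair_code (enc x) (enc_seq cC r)); split=> //.
    exists (pair_code (enc a) (enc (s a))); last by rewrite /= pair_codeK.
    by rewrite /= pair_codeK def_s.
  exists (enc (s a)); last by rewrite def_s; apply: (p_c (enc (x :: r))).
  exists (pair_code (enc a) (enc (s a))); last by rewrite /= pair_codeK.
  by rewrite /= pair_codeK def_s.
- by case: (s a).
Qed.

Lemma calc_cons {A B : Type} {cA : coded A} {cB : coded B}
  (f : A -> B) (g : A -> seq B) :
  calc f -> calc g -> calc (fun a => f a :: g a).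
Proof.
move=> [c f_c] [d g_d]; exists (CComp CSucc (CPair c d)) => a.
by exists (pair_code (enc (f a)) (enc (g a))) => //; exists (enc (f a)), (enc (g a)).
Qed.

Lemma size_enc_seq {B : Type} {cB : coded B}
  (s : seq B) : size s <= enc s.
Proof.
elim: s => //= x s IHs; rewrite ltnS (leq_trans IHs) //.
exact: leq_trans (leq_addl _ _) (pair_code_ge _ _).
Qed.

Lemma calc_iter {A B : Type} {cA : coded A} {cB : coded B}
  (n : A -> nat) (g : A -> B -> B) (z : A -> B) :
  calc n -> calc (fun q : A * B => g q.1 q.2) -> calc z ->
  calc (fun a => iter (n a) (g a) (z a)).
Proof.
move=> cn cg cz.
apply: calc_ext (calc_iteri (g := fun a _ => g a) cn _ cz).
  by move=> a; elim: (n a) => //= m ->.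
apply: (calc_app2 (F := g)) cg _ _; first exact: calc_fst calc_id.
exact: calc_snd (calc_snd calc_id).
Qed.

(** The only loops of the programming language are counted, so the list is
    consumed by iterating a step on pairs (rest of the list, accumulator). The
    code of a list is at least its size, hence a sufficient number of steps. *)
Lemma calc_foldl {A B C : Type} {cA : coded A} {cB : coded B} {cC : coded C}
  (g : A -> B -> C -> B) (z : A -> B) (s : A -> seq C) :
  calc (fun q : A * (B * C) => g q.1 q.2.1 q.2.2) -> calc z -> calc s ->
  calc (fun a => foldl (g a) (z a) (s a)).
Proof.
move=> cg cz cs.
pose step a (st : seq C * B) :=
  if st.1 is x :: r then (r, g a st.2 x) else st.
have stepE a n st : size st.1 <= n ->
    (iter n (step a) st).2 = foldl (g a) st.2 st.1.
  elim: n st => [|n IHn] [[|x r] b] //= le_n; rewrite -iterS iterSr.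
    exact: (IHn ([::], b)).
  exact: (IHn (r, g a b x)).
apply: (@calc_ext _ _ _ _ (fun a => (iter (enc (s a)) (step a) (s a, z a)).2)).
  by move=> a; rewrite stepE //= size_enc_seq.
apply/calc_snd/calc_iter; first exact: calc_encode.
  apply: (calc_case (g := fun q x r => (r, g q.1 q.2.2 x))).
  - exact: calc_fst (calc_snd calc_id).
  - exact: calc_snd calc_id.
  apply: calc_pair; first exact: calc_snd (calc_snd calc_id).
  apply: (calc_app3 (F := g)) => //; first exact: calc_fst (calc_fst calc_id).
    exact: calc_snd (calc_snd (calc_fst calc_id)).
  exact: calc_fst (calc_snd calc_id).
exact: calc_pair.
Qed.

Lemma calc_rev {A C : Type} {cA : coded A} {cC : coded C}
  (s : A -> seq C) : calc s -> calc (fun a => rev (s a)).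
Proof.
move=> cs; apply: calc_ext (calc_foldl (g := fun _ r x => x :: r) _ (calc_const [::]) cs).
  by move=> a; rewrite /rev; elim: (s a) [::] => //= x r IHr t; rewrite IHr.
apply: calc_cons; first exact: calc_snd (calc_snd calc_id).
exact: calc_fst (calc_snd calc_id).
Qed.

Lemma calc_foldr {A B C : Type} {cA : coded A} {cB : coded B} {cC : coded C}
  (g : A -> C -> B -> B) (z : A -> B) (s : A -> seq C) :
  calc (fun q : A * (C * B) => g q.1 q.2.1 q.2.2) -> calc z -> calc s ->
  calc (fun a => foldr (g a) (z a) (s a)).
Proof.
move=> cg cz cs.
apply: calc_ext (calc_foldl (g := fun a r x => g a x r) _ cz (calc_rev cs)).
  by move=> a; rewrite foldl_rev.
apply: (calc_app3 (F := g)) => //; first exact: calc_fst calc_id.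
  exact: calc_snd (calc_snd calc_id).
exact: calc_fst (calc_snd calc_id).
Qed.

Lemma calc_has {A C : Type} {cA : coded A} {cC : coded C}
  (P : A -> C -> bool) (s : A -> seq C) :
  calc (fun q : A * C => P q.1 q.2) -> calc s -> calc (fun a => has (P a) (s a)).
Proof.
move=> cP cs.
apply: calc_ext (calc_foldr (g := fun a x b => P a x || b) _ (calc_const false) cs).
  by move=> a; elim: (s a) => //= x r ->.
apply: calc_orb; last exact: calc_snd (calc_snd calc_id).
apply: (calc_app2 (F := P)) => //; first exact: calc_fst calc_id.
exact: calc_fst (calc_snd calc_id).
Qed.

Lemma calc_all {A C : Type} {cA : coded A} {cC : coded C}
  (P : A -> C -> bool) (s : A -> seq C) :
  calc (fun q : A * C => P q.1 q.2) -> calc s -> calc (fun a => all (P a) (s a)).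
Proof.
move=> cP cs; pose P' a x := ~~ P a x.
apply: calc_ext (calc_negb (calc_has (P := P') (calc_negb cP) cs)) => a.
by elim: (s a) => //= x r <-; rewrite negb_or negbK.
Qed.

Lemma calc_cat {A C : Type} {cA : coded A} {cC : coded C} (s t : A -> seq C) :
  calc s -> calc t -> calc (fun a => s a ++ t a).
Proof.
move=> cs ct.
apply: (@calc_ext _ _ _ _ (fun a => foldr (fun x r => x :: r) (t a) (s a))).
  by move=> a; elim: (s a) => //= x r ->.
apply: (calc_foldr (g := fun _ x r => x :: r)) => //.
apply: calc_cons; last exact: calc_snd (calc_snd calc_id).
exact: calc_fst (calc_snd calc_id).
Qed.

Lemma calc_size {A C : Type} {cA : coded A} {cC : coded C} (s : A -> seq C) :
  calc s -> calc (fun a => size (s a)).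
Proof.
move=> cs.
apply: (@calc_ext _ _ _ _ (fun a => foldr (fun _ n => n.+1) 0 (s a))).
  by move=> a; elim: (s a) => //= x r ->.
apply: (calc_foldr (g := fun _ _ n => n.+1)) => //; last exact: calc_const.
exact: calc_succ (calc_snd (calc_snd calc_id)).
Qed.

Lemma calc_sum {A C : Type} {cA : coded A} {cC : coded C}
  (F : A -> C -> nat) (s : A -> seq C) :
  calc (fun q : A * C => F q.1 q.2) -> calc s ->
  calc (fun a => \sum_(x <- s a) F a x).
Proof.
move=> cF cs.
apply: (@calc_ext _ _ _ _ (fun a => foldr (fun x n => F a x + n) 0 (s a))).
  by move=> a; elim: (s a) => [|x r IHr]; rewrite ?big_nil ?big_cons //= IHr.
apply: (calc_foldr (g := fun a x n => F a x + n)) => //; last exact: calc_const.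
apply: calc_addn; last exact: calc_snd (calc_snd calc_id).
apply: (calc_app2 (F := F)) => //; first exact: calc_fst calc_id.
exact: calc_fst (calc_snd calc_id).
Qed.

Lemma calc_mem {A : Type} {T : eqType} {cA : coded A} {cT : coded T}
  (f : A -> T) (s : A -> seq T) :
  calc f -> calc s -> calc (fun a => f a \in s a).
Proof.
move=> cf cs.
apply: calc_ext (calc_has (P := fun a x => f a == x) _ cs).
  by move=> a; elim: (s a) => //= x r ->; rewrite inE.
apply: calc_eq; last exact: calc_snd calc_id.
exact: calc_comp cf (calc_fst calc_id).
Qed.

Lemma calc_nseq {A C : Type} {cA : coded A} {cC : coded C}
  (n : A -> nat) (f : A -> C) :
  calc n -> calc f -> calc (fun a => nseq (n a) (f a)).
Proof.
move=> cn cf; apply: (calc_iter (g := fun a r => f a :: r)) => //.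
  apply: calc_cons; last exact: calc_snd calc_id.
  exact: calc_comp cf (calc_fst calc_id).
exact: calc_const.
Qed.

Lemma calc_iota {A : Type} {cA : coded A} (n : A -> nat) :
  calc n -> calc (fun a => iota 0 (n a)).
Proof.
move=> cn.
apply: calc_ext (calc_iteri (g := fun _ i r => r ++ [:: i]) cn _ (calc_const [::])).
  by move=> a; elim: (n a) => // k IHk; rewrite -(addn1 k) iotaD -IHk addn1.
apply: calc_cat; first exact: calc_snd (calc_snd calc_id).
by apply: calc_cons; [exact: calc_fst (calc_snd calc_id) | exact: calc_const].
Qed.

Lemma calc_find {A C : Type} {cA : coded A} {cC : coded C}
  (P : A -> C -> bool) (s : A -> seq C) :
  calc (fun q : A * C => P q.1 q.2) -> calc s -> calc (fun a => find (P a) (s a)).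
Proof.
move=> cP cs.
apply: (@calc_ext _ _ _ _
  (fun a => foldr (fun x n => if P a x then 0 else n.+1) 0 (s a))).
  by move=> a; elim: (s a) => //= x r ->.
apply: (calc_foldr (g := fun a x n => if P a x then 0 else n.+1)) => //.
  apply: calc_if; [|exact: calc_const|exact: calc_succ (calc_snd (calc_snd calc_id))].
  apply: (calc_app2 (F := P)) => //; first exact: calc_fst calc_id.
  exact: calc_fst (calc_snd calc_id).
exact: calc_const.
Qed.

(** Unbounded search, stated for a function that is known to be the result. *)
Lemma calc_least {A : Type} {cA : coded A} (P : A -> nat -> bool) (f : A -> nat) :
  calc (fun q : A * nat => P q.1 q.2) ->
  (forall a, P a (f a)) -> (forall a i, i < f a -> ~~ P a i) -> calc f.
Proof.
move=> cP Pf minf.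
have [c c_P] := calc_nat_of_bool (calc_negb cP).
exists (CMin c) => a; split; first by have := c_P (a, f a); rewrite /= Pf.
by move=> i lt_i; exists 0; have := c_P (a, i); rewrite /= (minf a).
Qed.

Lemma calc_count {A C : Type} {cA : coded A} {cC : coded C}
  (P : A -> C -> bool) (s : A -> seq C) :
  calc (fun q : A * C => P q.1 q.2) -> calc s -> calc (fun a => count (P a) (s a)).
Proof.
move=> cP cs; apply: calc_ext (calc_sum (F := fun a x => nat_of_bool (P a x)) _ cs).
  by move=> a; elim: (s a) => [|x r IHr]; rewrite ?big_nil ?big_cons /= ?IHr.
exact: calc_nat_of_bool.
Qed.

(** Closes computability goals by recursion on the syntax of the function. *)
Ltac calc_step :=
  lazymatch goal with
  | |- calc (fun _ => ?b) => exact: calc_const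
  | |- calc (fun a => a) => exact: calc_id
  | |- calc (@fst _ _) => exact: (calc_fst calc_id)
  | |- calc (@snd _ _) => exact: (calc_snd calc_id)
  | |- calc S => exact: (calc_succ calc_id)
  | |- calc predn => exact: (calc_pred calc_id)
  | |- calc (fun a => (@?f a, @?g a)) => apply: calc_pair
  | |- calc (fun a => (@?f a).1) => apply: calc_fst
  | |- calc (fun a => (@?f a).2) => apply: calc_snd
  | |- calc (fun a => @?f a && @?g a) => apply: calc_andb
  | |- calc (fun a => @?f a || @?g a) => apply: calc_orb
  | |- calc (fun a => ~~ (@?f a)) => apply: calc_negb
  | |- calc (fun a => @?f a \in @?s a) => apply: calc_mem
  | |- calc (fun a => @?f a <= @?g a) => apply: calc_leq
  | |- calc (fun a => @?f a == @?g a) => apply: calc_eq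
  | |- calc (fun a => (@?f a).+1) => apply: calc_succ
  | |- calc (fun a => (@?f a).-1) => apply: calc_pred
  | |- calc (fun a => @?f a + @?g a) => apply: calc_addn
  | |- calc (fun a => @?f a - @?g a) => apply: calc_subn
  | |- calc (fun a => @?f a * @?g a) => apply: calc_muln
  | |- calc (fun a => (@?f a)`!) => apply: calc_factorial
  | |- calc (fun a => pair_code (@?f a) (@?g a)) => apply: calc_pair_code
  | |- calc (fun a => Cantor.of_nat (@?f a)) => apply: calc_unpair
  | |- calc (fun a => has (@?P a) (@?s a)) => apply: calc_has
  | |- calc (fun a => all (@?P a) (@?s a)) => apply: calc_all
  | |- calc (fun a => find (@?P a) (@?s a)) => apply: calc_find
  | |- calc (fun a => nseq (@?n a) (@?f a)) => apply: calc_nseq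
  | |- calc (fun a => iota 0 (@?n a)) => apply: calc_iota
  | |- calc (fun a => @?s a ++ @?t a) => apply: calc_cat
  | |- calc (fun a => @?f a :: @?g a) => apply: calc_cons
  | |- calc (fun a => size (@?s a)) => apply: calc_size
  | |- calc (fun a => enc (@?f a)) => apply: calc_encode
  | |- calc (fun a => dec (@?f a)) => apply: calc_dec
  | |- calc (fun a => if _ then _ else _) => apply: calc_if
  end.

Ltac calc := lazy beta; repeat (first [assumption | calc_step]; lazy beta).

(** * The universal relation *)

(** The triple (e, (x, y)) stands for the assertion that the program with index e
    maps x to y. *)
Definition claim : Type := nat * (nat * nat).

(** The predicates [step_...] are the evaluation rules with a premise or two
    taken from [r]. Subprograms are read off the premises rather than decoded from
    the index of the program; in the two recursion rules one of the two
    subprograms does not occur in the premises and is searched below the index. *)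
Definition step_pair (t : claim) (r : seq claim) : bool :=
  has (fun t1 => has (fun t2 =>
    [&& t.1 == 4 * pair_code t1.1 t2.1 + 4, t1.2.1 == t.2.1, t2.2.1 == t.2.1
      & t.2.2 == pair_code t1.2.2 t2.2.2]) r) r.

Definition step_comp (t : claim) (r : seq claim) : bool :=
  has (fun t1 => has (fun t2 =>
    [&& t.1 == 4 * pair_code t1.1 t2.1 + 5, t2.2.1 == t.2.1, t1.2.1 == t2.2.2
      & t1.2.2 == t.2.2]) r) r.

Definition step_prec0 (t : claim) (r : seq claim) : bool :=
  ((Cantor.of_nat t.2.1).2 == 0) &&
  has (fun t1 =>
    [&& t1.2.1 == (Cantor.of_nat t.2.1).1, t1.2.2 == t.2.2
      & has (fun c2 => t.1 == 4 * pair_code t1.1 c2 + 6) (iota 0 t.1)]) r.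

Definition step_precS (t : claim) (r : seq claim) : bool :=
  (0 < (Cantor.of_nat t.2.1).2) &&
  has (fun t1 => has (fun t2 =>
    [&& t1.1 == t.1,
        t1.2.1 == pair_code (Cantor.of_nat t.2.1).1 (Cantor.of_nat t.2.1).2.-1,
        t2.2.1 == pair_code (Cantor.of_nat t.2.1).1
                    (pair_code (Cantor.of_nat t.2.1).2.-1 t1.2.2),
        t2.2.2 == t.2.2
      & has (fun c1 => t.1 == 4 * pair_code c1 t2.1 + 6) (iota 0 t.1)]) r) r.

Definition step_min (t : claim) (r : seq claim) : bool :=
  has (fun t1 =>
    [&& t.1 == 4 * t1.1 + 7, t1.2.1 == pair_code t.2.1 t.2.2, t1.2.2 == 0
      & all (fun i => has (fun t2 =>
          [&& t2.1 == t1.1, t2.2.1 == pair_code t.2.1 i & 0 < t2.2.2]) r)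
          (iota 0 t.2.2)]) r.

Definition justified (t : claim) (r : seq claim) : bool :=
  [|| (t.1 == 0) && (t.2.2 == 0), (t.1 == 1) && (t.2.2 == t.2.1.+1),
      (t.1 == 2) && (t.2.2 == (Cantor.of_nat t.2.1).1),
      (t.1 == 3) && (t.2.2 == (Cantor.of_nat t.2.1).2),
      step_pair t r, step_comp t r, step_prec0 t r, step_precS t r
    | step_min t r].

Fixpoint valid (w : seq claim) : bool :=
  if w is t :: r then justified t r && valid r else true.

Lemma calc_justified {A : Type} {cA : coded A} (t : A -> claim) (r : A -> seq claim) :
  calc t -> calc r -> calc (fun a => justified (t a) (r a)).
Proof.
apply: calc_app2; rewrite /justified /step_pair /step_comp /step_prec0.
rewrite /step_precS /step_min /claim.
calc.
Qed.

Lemma calc_valid {A : Type} {cA : coded A} (w : A -> seq claim) :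
  calc w -> calc (fun a => valid (w a)).
Proof.
move=> cw.
pose push (t : claim) (rb : seq claim * bool) :=
  (t :: rb.1, justified t rb.1 && rb.2).
apply: (@calc_ext _ _ _ _ (fun a => (foldr push ([::], true) (w a)).2)).
  move=> a; suff -> : foldr push ([::], true) (w a) = (w a, valid (w a)) by [].
  by elim: (w a) => //= t r ->.
apply/calc_snd/(calc_foldr (g := fun _ => push)) => //; last exact: calc_const.
by rewrite /push; calc; apply: calc_justified; calc.
Qed.
Definition holds (t : claim) : Prop := phi t.1 t.2.1 t.2.2.

(** Every number is an index because it is either below 4 or of the form
    4 q + r + 4 with r < 4, and the pairing is onto. *)
Lemma encode_surj (n : nat) : exists c, encode c = n.
Proof.
elim/ltn_ind: n => n IHn.
have [lt_n4|le_4n] := ltnP n 4.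
  by case: n lt_n4 {IHn} => [|[|[|[|]]]] // _;
    [exists CZero | exists CSucc | exists CLeft | exists CRight].
have e_n : n = 4 * ((n - 4) %/ 4) + (n - 4) %% 4 + 4 by lia.
have lt_r : (n - 4) %% 4 < 4 by lia.
case: (Cantor.of_nat ((n - 4) %/ 4)) (Cantor.cancel_to_of ((n - 4) %/ 4)) => a b.
rewrite -/(pair_code a b) => e_ab; have := pair_code_ge a b.
move: ((n - 4) %% 4) ((n - 4) %/ 4) e_ab e_n lt_r => r q <- e_n lt_r le_ab.
have [|c1 e1] := IHn a; first by lia.
have [|c2 e2] := IHn b; first by lia.
have [|c0 e0] := IHn (pair_code a b); first by lia.
case: r e_n lt_r => [|[|[|[|]]]] // e_n _.
- by exists (CPair c1 c2); rewrite /= e1 e2; lia.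
- by exists (CComp c1 c2); rewrite /= e1 e2; lia.
- by exists (CPrec c1 c2); rewrite /= e1 e2; lia.
- by exists (CMin c0); rewrite /= e0; lia.
Qed.

Lemma eval_prec0 (c1 c2 : code) (x y : nat) :
  (Cantor.of_nat x).2 = 0 -> eval c1 (Cantor.of_nat x).1 y ->
  eval (CPrec c1 c2) x y.
Proof. by rewrite /=; case: (Cantor.of_nat x) => a n /= -> c1_y; exists (fun=> y). Qed.

Lemma eval_precS (c1 c2 : code) (a n x y z : nat) :
  Cantor.of_nat x = (a, n.+1) -> eval (CPrec c1 c2) (pair_code a n) y ->
  eval c2 (pair_code a (pair_code n y)) z -> eval (CPrec c1 c2) x z.
Proof.
rewrite /= pair_codeK => -> [h [h0 hS ->]] c2_z.
exists (fun i => if i <= n then h i else z); split=> //; last by rewrite ltnn.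
move=> i; rewrite ltnS => le_in.
have [->|lt_in] := eqVneq i n; first by rewrite leqnn ltnn.
have {}lt_in : i < n by lia.
by rewrite le_in lt_in; apply: hS.
Qed.

Lemma justified_sound (t : claim) (r : seq claim) :
  {in r, forall u, holds u} -> justified t r -> holds t.
Proof.
case: t => e [x y] r_ok; rewrite /holds /= => /or4P[/andP[] /=|/andP[] /=|/andP[] /=|].
- by move=> /eqP-> /eqP->; exists CZero.
- by move=> /eqP-> /eqP->; exists CSucc.
- by move=> /eqP-> /eqP->; exists CLeft.
case/or4P=> [/andP[] /=|||].
- by move=> /eqP-> /eqP->; exists CRight.
- case/hasP=> -[e1 [x1 y1]] /r_ok[/= c1 <- c1_y] /hasP[[e2 [x2 y2]]] /r_ok[/= c2 <- c2_y].
  case/and4P=> /= /eqP-> /eqP<- /eqP e_x /eqP->; exists (CPair c1 c2) => //=.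
  by exists y1, y2; split=> //; rewrite -e_x.
- case/hasP=> -[e1 [x1 y1]] /r_ok[/= c1 <- c1_y] /hasP[[e2 [x2 y2]]] /r_ok[/= c2 <- c2_y].
  case/and4P=> /= /eqP-> /eqP<- /eqP e_x /eqP<-; exists (CComp c1 c2) => //=.
  by exists y2; rewrite // -e_x.
case/or3P=> [/andP[/= /eqP n0] | /andP[/= n_gt0] |].
- case/hasP=> -[e1 [x1 y1]] /r_ok[/= c1 <- c1_y].
  case/and3P=> /= /eqP e_x /eqP e_y /hasP[e2 _ /eqP->].
  have [c2 <-] := encode_surj e2.
  by exists (CPrec c1 c2) => //; apply: eval_prec0; rewrite // -e_x -e_y.
- case/hasP=> -[e1 [x1 y1]] /r_ok[/= c c_e c_y1] /hasP[[e2 [x2 y2]]] /r_ok[/= c2 <- c2_y].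
  case/and5P=> /= /eqP e_e /eqP e_x1 /eqP e_x2 /eqP e_y /hasP[e0 _ /eqP e_c].
  have [c1 e_c1] := encode_surj e0.
  have e_cc : c = CPrec c1 c2 by apply: encode_inj; rewrite c_e e_e e_c -e_c1.
  exists c; first by rewrite c_e.
  rewrite e_cc in c_y1 *.
  apply: (@eval_precS c1 c2 (Cantor.of_nat x).1 (Cantor.of_nat x).2.-1 x y1 y).
  + by rewrite prednK // -surjective_pairing.
  + by rewrite -e_x1.
  + by rewrite -e_x2 -e_y.
- case/hasP=> -[e1 [x1 y1]] /r_ok[/= c1 <- c1_y].
  case/and4P=> /= /eqP-> /eqP e_x /eqP e_y /allP min_y.
  exists (CMin c1) => //=; split; first by rewrite -e_x -e_y.
  move=> i lt_iy; have := min_y i; rewrite mem_iota => /(_ lt_iy) /hasP[[e2 [x2 y2]]].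
  case/r_ok=> /= c2 <- c2_y /and3P[/= /eqP e_c /eqP <- y2_gt0].
  by exists y2.-1; rewrite prednK // -(encode_inj e_c).
Qed.

Lemma valid_sound (w : seq claim) : valid w -> {in w, forall t, holds t}.
Proof.
elim: w => //= t r IHr /andP[/justified_sound t_ok /IHr r_ok] u.
by rewrite inE => /predU1P[->|/r_ok //]; apply: t_ok.
Qed.

Lemma sub_has (T : eqType) (P Q : pred T) (r s : seq T) :
  {subset r <= s} -> subpred P Q -> has P r -> has Q s.
Proof.
by move=> sub_rs sub_PQ /hasP[x x_r /sub_PQ Qx]; apply/hasP; exists x; rewrite ?sub_rs.
Qed.

Lemma justified_sub (t : claim) (r s : seq claim) :
  {subset r <= s} -> justified t r -> justified t s.
Proof.
move=> sub_rs; have mono P Q := @sub_has _ P Q r s sub_rs.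
rewrite /justified; case/or4P=> [->|->|->|]; rewrite ?orbT //.
case/or4P=> [->|just|just|just]; rewrite ?orbT //; do 3![apply/orP; right].
- apply/orP; right; apply/orP; left.
  by apply: (mono) just => t1; apply: (mono).
- apply/orP; right; apply/orP; right; apply/orP; left.
  by apply: (mono) just => t1; apply: (mono).
do 3![apply/orP; right].
case/or3P: just => [/andP[n0 just]|/andP[n_gt0 just]|just].
- by rewrite /step_prec0 n0 (mono _ _ _ just).
- apply/orP; right; apply/orP; left; rewrite /step_precS n_gt0 /=.
  by apply: (mono) just => t1; apply: (mono).
apply/orP; right; apply/orP; right; apply: (mono) just => t1 /and4P[-> -> ->] /=.
by apply: sub_all => i; apply: (mono).
Qed.

(** Certificates can be merged since a rule only asks for the presence of its
    premises. *)
Lemma valid_cat (w1 w2 : seq claim) : valid w1 -> valid w2 -> valid (w1 ++ w2).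
Proof.
move=> + ok2; elim: w1 => //= t r IHr /andP[just_t /IHr->]; rewrite andbT.
by apply: justified_sub just_t => u; rewrite mem_cat => ->.
Qed.

Definition certified (t : claim) : Prop := exists2 w, valid w & t \in w.

Lemma certify (t : claim) (r : seq claim) :
  valid r -> justified t r -> certified t.
Proof. by move=> ok_r just_t; exists (t :: r); rewrite ?mem_head //= just_t. Qed.

Lemma certified2 (t u : claim) :
  certified t -> certified u -> exists w, [/\ valid w, t \in w & u \in w].
Proof.
move=> [w1 ok1 t1] [w2 ok2 u2]; exists (w1 ++ w2).
by rewrite valid_cat // !mem_cat t1 u2 orbT.
Qed.

Lemma eval_certified (c : code) (x y : nat) :
  eval c x y -> certified (encode c, (x, y)).
Proof.
elim: c x y => [||||c1 I1 c2 I2|c1 I1 c2 I2|c1 I1 c2 I2|c1 I1] x y.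
1-4: by move=> e_y; apply: (@certify _ [::]) => //; rewrite /justified /= e_y eqxx ?orbT.
- move=> /= [a [b [/I1 c1_a /I2 c2_b ->]]].
  have [w [ok_w w1 w2]] := certified2 c1_a c2_b; apply: certify ok_w _.
  rewrite /justified; do 4![apply/orP; right]; apply/orP; left.
  apply/hasP; exists (encode c1, (x, a)) => //.
  by apply/hasP; exists (encode c2, (x, b)) => //=; rewrite !eqxx.
- move=> /= [a /I2 c2_a /I1 c1_y].
  have [w [ok_w w1 w2]] := certified2 c1_y c2_a; apply: certify ok_w _.
  rewrite /justified; do 5![apply/orP; right]; apply/orP; left.
  apply/hasP; exists (encode c1, (a, y)) => //.
  by apply/hasP; exists (encode c2, (x, a)) => //=; rewrite !eqxx.
- rewrite -[x]Cantor.cancel_to_of /= Cantor.cancel_of_to.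
  case: (Cantor.of_nat x) => a n [h [h0 hS ->]]; rewrite -/(pair_code a n).
  elim: n hS => [|n IHn] hS.
    have [w ok_w w0] := I1 _ _ h0; apply: certify ok_w _.
    rewrite /justified; do 6![apply/orP; right]; apply/orP; left.
    rewrite /step_prec0 /= pair_codeK /=.
    apply/hasP; exists (encode c1, (a, h 0)) => //=; rewrite !eqxx /=.
    apply/hasP; exists (encode c2) => //; rewrite mem_iota.
    by have := pair_code_ge (encode c1) (encode c2); lia.
  have c_n : certified (encode (CPrec c1 c2), (pair_code a n, h n)).
    by apply: IHn => i lt_in; apply: hS; lia.
  have [w [ok_w w1 w2]] := certified2 c_n (I2 _ _ (hS n (ltnSn n))).
  apply: certify ok_w _.
  rewrite /justified; do 7![apply/orP; right]; apply/orP; left.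
  pose t : claim := (encode (CPrec c1 c2), (pair_code a n.+1, h n.+1)).
  have x_K : Cantor.of_nat t.2.1 = (a, n.+1) by exact: pair_codeK.
  rewrite /step_precS x_K /=.
  apply/hasP; exists (encode (CPrec c1 c2), (pair_code a n, h n)) => //.
  apply/hasP; exists (encode c2, (pair_code a (pair_code n (h n)), h n.+1)) => //=.
  rewrite !eqxx /=; apply/hasP; exists (encode c1) => //; rewrite mem_iota.
  by have := pair_code_ge (encode c1) (encode c2); lia.
move=> /= [/I1 c_0 c_pos].
have [w [ok_w w0 w_pos]] : exists w, [/\ valid w,
    (encode c1, (pair_code x y, 0)) \in w &
    forall i, i < y -> exists m, (encode c1, (pair_code x i, m.+1)) \in w].
  elim: {1 3}y c_pos => [_|k IHk c_pos]; first by have [w ? ?] := c_0; exists w.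
  have [|w [ok_w w0 w_pos]] := IHk; first by move=> i lt_ik; apply: c_pos; lia.
  have [m /I1[v ok_v v_m]] := c_pos k (ltnSn k).
  exists (w ++ v); rewrite valid_cat // mem_cat w0; split=> // i.
  rewrite ltnS leq_eqVlt => /predU1P[->|/w_pos[m' w_m]].
    by exists m; rewrite mem_cat v_m orbT.
  by exists m'; rewrite mem_cat w_m.
apply: certify ok_w _; rewrite /justified; do 8![apply/orP; right].
apply/hasP; exists (encode c1, (pair_code x y, 0)) => //=; rewrite !eqxx /=.
apply/allP => i; rewrite mem_iota => /andP[_ /w_pos[m w_m]].
by apply/hasP; exists (encode c1, (pair_code x i, m.+1)) => //=; rewrite !eqxx.
Qed.

(** Kleene's normal form: the relation [phi] is semidecidable uniformly in the
    index. *)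
Lemma phiP (e x y : nat) :
  phi e x y <-> exists w, valid w && ((e, (x, y)) \in w).
Proof.
split=> [[c <- /eval_certified[w ok_w w_c]]|[w /andP[/valid_sound ok_w]]].
  by exists w; rewrite ok_w.
exact: ok_w.
Qed.

(** * Semidecidable and Pi-2 predicates *)

Definition semidec {A : Type} {cA : coded A} (P : A -> Prop) : Prop :=
  exists2 r : A -> nat -> bool,
    calc (fun q : A * nat => r q.1 q.2) & forall a, P a <-> exists n, r a n.

Definition pi2 {A : Type} {cA : coded A} (P : A -> Prop) : Prop :=
  exists2 r : A -> nat -> nat -> bool,
    calc (fun q : A * (nat * nat) => r q.1 q.2.1 q.2.2) &
    forall a, P a <-> forall n, exists m, r a n m.

Lemma semidec_iff {A : Type} {cA : coded A} (P Q : A -> Prop) :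
  (forall a, P a <-> Q a) -> semidec P -> semidec Q.
Proof. by move=> PQ [r c_r rP]; exists r => // a; rewrite -PQ. Qed.

Lemma pi2_iff {A : Type} {cA : coded A} (P Q : A -> Prop) :
  (forall a, P a <-> Q a) -> pi2 P -> pi2 Q.
Proof. by move=> PQ [r c_r rP]; exists r => // a; rewrite -PQ. Qed.

Lemma semidec_calc {A : Type} {cA : coded A} (b : A -> bool) :
  calc b -> semidec (fun a => b a).
Proof.
move=> cb; exists (fun a _ => b a); first by apply: (calc_comp cb); calc.
by move=> a; split=> [|[]//]; exists 0.
Qed.

Lemma semidec_and {A : Type} {cA : coded A} (P Q : A -> Prop) :
  semidec P -> semidec Q -> semidec (fun a => P a /\ Q a).
Proof.
move=> [r c_r rP] [s c_s sQ].
exists (fun a n => r a (Cantor.of_nat n).1 && s a (Cantor.of_nat n).2).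
  by apply: calc_andb; [apply: (calc_app2 c_r) | apply: (calc_app2 c_s)]; calc.
move=> a; split=> [[/rP[n r_n] /sQ[m s_m]]|[n /andP[r_n s_n]]].
  by exists (pair_code n m); rewrite pair_codeK r_n.
by split; [apply/rP; exists (Cantor.of_nat n).1 | apply/sQ; exists (Cantor.of_nat n).2].
Qed.

Lemma semidec_or {A : Type} {cA : coded A} (P Q : A -> Prop) :
  semidec P -> semidec Q -> semidec (fun a => P a \/ Q a).
Proof.
move=> [r c_r rP] [s c_s sQ]; exists (fun a n => r a n || s a n).
  by apply: calc_orb; [apply: (calc_app2 c_r) | apply: (calc_app2 c_s)]; calc.
move=> a; split=> [[/rP[n r_n]|/sQ[n s_n]]|[n /orP[r_n|s_n]]].
- by exists n; rewrite r_n.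
- by exists n; rewrite s_n orbT.
- by left; apply/rP; exists n.
- by right; apply/sQ; exists n.
Qed.

Lemma semidec_ex {A T : Type} {cA : coded A} {cT : coded T} {dT : decoded T}
  (P : A -> T -> Prop) :
  semidec (fun q : A * T => P q.1 q.2) -> semidec (fun a => exists t, P a t).
Proof.
move=> [r c_r rP].
exists (fun a n => r (a, dec (Cantor.of_nat n).1) (Cantor.of_nat n).2).
  by apply: (calc_app2 c_r); calc.
move=> a; split=> [[t /(rP (a, t))[n r_n]]|[n r_n]].
  by exists (pair_code (enc t) n); rewrite pair_codeK /= encK.
by exists (dec (Cantor.of_nat n).1); apply/(rP (a, _)); exists (Cantor.of_nat n).2.
Qed.

Lemma pi2_semidec {A : Type} {cA : coded A} (P : A -> Prop) :
  semidec P -> pi2 P.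
Proof.
move=> [r c_r rP]; exists (fun a _ => r a).
  by apply: (calc_app2 c_r); calc.
by move=> a; rewrite rP; split=> [|/(_ 0)].
Qed.

Lemma pi2_and {A : Type} {cA : coded A} (P Q : A -> Prop) :
  pi2 P -> pi2 Q -> pi2 (fun a => P a /\ Q a).
Proof.
move=> [r c_r rP] [s c_s sQ].
exists (fun a n m => r a n (Cantor.of_nat m).1 && s a n (Cantor.of_nat m).2).
  by apply: calc_andb; [apply: (calc_app3 c_r) | apply: (calc_app3 c_s)]; calc.
move=> a; split=> [[/rP r_n /sQ s_n] n|rs].
  have [[k r_k] [m s_m]] := (r_n n, s_n n).
  by exists (pair_code k m); rewrite pair_codeK r_k.
split; [apply/rP | apply/sQ] => n; have [m /andP[r_m s_m]] := rs n.
  by exists (Cantor.of_nat m).1.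
by exists (Cantor.of_nat m).2.
Qed.

Lemma pi2_all {A T : Type} {cA : coded A} {cT : coded T} {dT : decoded T}
  (P : A -> T -> Prop) :
  pi2 (fun q : A * T => P q.1 q.2) -> pi2 (fun a => forall t, P a t).
Proof.
move=> [r c_r rP].
exists (fun a n => r (a, dec (Cantor.of_nat n).1) (Cantor.of_nat n).2).
  by apply: (calc_app3 c_r); calc.
move=> a; split=> [Pa n|r_n t].
  by apply: (iffLR (rP (a, dec (Cantor.of_nat n).1))).
apply/(rP (a, t)) => n; have [m] := r_n (pair_code (enc t) n).
by rewrite pair_codeK /= encK; exists m.
Qed.

Lemma computable_rel4P (R : nat -> nat -> nat -> nat -> bool) :
  computable_rel4 R <->
  calc (fun q : nat * (nat * (nat * nat)) => R q.1 q.2.1 q.2.2.1 q.2.2.2).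
Proof.
split=> [[e R_e]|[c R_c]].
  have [c c_e _] := R_e 0 0 0 0; exists c => -[x [y1 [y2 y3]]] /=.
  by have [d d_e d_R] := R_e x y1 y2 y3; rewrite -(encode_inj (etrans d_e (esym c_e))).
by exists (encode c) => x y1 y2 y3; exists c => //; apply: (R_c (x, (y1, (y2, y3)))).
Qed.

Lemma Sigma03_ex {T : Type} {cT : coded T} {dT : decoded T} (P : nat -> T -> Prop) :
  pi2 (fun q : nat * T => P q.1 q.2) -> Sigma03 (fun x => exists t, P x t).
Proof.
move=> [r c_r rP]; exists (fun x y => r (x, dec y)).
  by apply/computable_rel4P; apply: (calc_app3 c_r); calc.
move=> x; split=> [[t /(rP (x, t)) Pt]|[y r_y]].
  by exists (enc t); rewrite encK.
by exists (dec y); apply/(rP (x, _)).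
Qed.

Lemma semidec_phi {A : Type} {cA : coded A} (e x y : A -> nat) :
  calc e -> calc x -> calc y -> semidec (fun a => phi (e a) (x a) (y a)).
Proof.
move=> ce cx cy.
apply: (semidec_iff (P := fun a => exists w,
          valid w && (((e a, (x a, y a)) : claim) \in w))).
  by move=> a; rewrite phiP.
apply: (semidec_ex (P := fun a w => valid w && (((e a, (x a, y a)) : claim) \in w))).
apply/semidec_calc/calc_andb; first by apply: calc_valid; calc.
by apply: calc_mem; calc; [apply: (calc_comp ce) | apply: (calc_comp cx)
  | apply: (calc_comp cy)]; calc.
Qed.

Lemma computableP (f : nat -> nat) : computable f <-> calc f.
Proof.
split=> [[e f_e]|[c f_c]]; last by exists (encode c) => x; exists c; last exact: f_c.
have [c c_e _] := f_e 0; exists c => x.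
by have [d d_e d_f] := f_e x; rewrite -(encode_inj (etrans d_e (esym c_e))).
Qed.

Lemma phi_det (e x y z : nat) : phi e x y -> phi e x z -> y = z.
Proof. by move=> [c <- c_y] [d /encode_inj -> d_z]; apply: eval_det c_y d_z. Qed.

(** * Indices of composed programs *)

(** The indices of a pairing, of a composition and of a constant program, as
    functions of indices that need not be given as programs. *)
Definition pair_num (e k : nat) : nat := 4 * pair_code e k + 4.
Definition comp_num (e k : nat) : nat := 4 * pair_code e k + 5.
Definition const_num (n : nat) : nat := iter n (comp_num 1) 0.

Lemma phi_pair (e k x y : nat) :
  phi (pair_num e k) x y <->
  exists a b, [/\ phi e x a, phi k x b & y = pair_code a b].
Proof.
have [[c1 <-] [c2 <-]] := (encode_surj e, encode_surj k).
split=> [[c /(@encode_inj c (CPair c1 c2)) -> [a [b [c1_a c2_b ->]]]]|].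
  by exists a, b; split=> //; [exists c1 | exists c2].
move=> [a [b [[d1 /encode_inj -> d1_a] [d2 /encode_inj -> d2_b] ->]]].
by exists (CPair c1 c2) => //; exists a, b.
Qed.

Lemma phi_comp (e k x y : nat) :
  phi (comp_num e k) x y <-> exists2 a, phi k x a & phi e a y.
Proof.
have [[c1 <-] [c2 <-]] := (encode_surj e, encode_surj k).
split=> [[c /(@encode_inj c (CComp c1 c2)) -> [a c2_a c1_y]]|].
  by exists a; [exists c2 | exists c1].
move=> [a [d2 /encode_inj -> d2_a] [d1 /encode_inj -> d1_y]].
by exists (CComp c1 c2) => //; exists a.
Qed.

Lemma phi_const (n x y : nat) : phi (const_num n) x y <-> y = n.
Proof.
elim: n y => [|n IHn] y.
  by split=> [[c /(@encode_inj c CZero) ->]|->] //; exists CZero.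
rewrite /const_num iterS phi_comp; split=> [[a /IHn -> [c]]|->].
  by move=> /(@encode_inj c CSucc) ->.
by exists n; [apply/IHn | exists CSucc].
Qed.

Lemma calc_pair_num {A : Type} {cA : coded A} (e k : A -> nat) :
  calc e -> calc k -> calc (fun a => pair_num (e a) (k a)).
Proof. by move=> ce ck; rewrite /pair_num; calc. Qed.

Lemma calc_comp_num {A : Type} {cA : coded A} (e k : A -> nat) :
  calc e -> calc k -> calc (fun a => comp_num (e a) (k a)).
Proof. by move=> ce ck; rewrite /comp_num; calc. Qed.

Lemma calc_const_num {A : Type} {cA : coded A} (n : A -> nat) :
  calc n -> calc (fun a => const_num (n a)).
Proof.
move=> cn; apply: (calc_iter (g := fun _ => comp_num 1)) => //.
  by apply: calc_comp_num; calc.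
exact: calc_const.
Qed.

(** The s-m-n theorem for total functions of two variables: an index of [f x] is
    the index of [f] composed with the pairing of the constant x and the
    identity. *)
Lemma calc_smn (f : nat -> nat -> nat) :
  calc (fun q : nat * nat => f q.1 q.2) ->
  exists2 g : nat -> nat, computable g & forall x y, phi (g x) y (f x y).
Proof.
move=> [c f_c].
have [d id_d] : calc (fun n : nat => n) by exact: calc_id.
exists (fun x => comp_num (encode c) (pair_num (const_num x) (encode d))).
  apply/computableP/calc_comp_num; first exact: calc_const.
  by apply: calc_pair_num; calc; apply: calc_const_num; calc.
move=> x y; apply/phi_comp; exists (pair_code x y); last first.
  by exists c => //; apply: (f_c (x, y)).
apply/phi_pair; exists x, y; split=> //; first exact/phi_const.
by exists d => //; apply: id_d.
Qed.

(** * Finite sets that generate up to multiples *)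

Section Spans.

Local Open Scope ring_scope.
Import GRing.Theory.

Variable V : zmodType.
Implicit Types (s t : seq V) (x y : V) (B H K : V -> Prop).

(** The subgroup generated by [s]. An integer combination is presented as a
    difference of two sums of entries with repetitions, which avoids integer
    coefficients in the computability part. *)
Definition in_span s x : Prop :=
  exists p q : seq V,
    [/\ {subset p <= s}, {subset q <= s} & x + \sum_(y <- p) y = \sum_(y <- q) y].

(** The pure subgroup generated by [s]: every element has a positive multiple in
    the span, whence the successor. *)
Definition pure s x : Prop := exists n, in_span s (x *+ n.+1).

Lemma span0 s : in_span s 0.
Proof. by exists [::], [::]; split=> //; rewrite big_nil addr0. Qed.

Lemma span_gen s x : x \in s -> in_span s x.
Proof.
move=> s_x; exists [::], [:: x]; split=> //.
  by move=> y; rewrite inE => /eqP->.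
by rewrite big_nil big_seq1 addr0.
Qed.

Lemma subset_cat (T : eqType) (p q r : seq T) :
  {subset p <= r} -> {subset q <= r} -> {subset p ++ q <= r}.
Proof. by move=> sp sq y; rewrite mem_cat => /orP[/sp|/sq]. Qed.

Lemma spanD s x y : in_span s x -> in_span s y -> in_span s (x + y).
Proof.
move=> [p [q [sp sq e]]] [p' [q' [sp' sq' e']]].
exists (p ++ p'), (q ++ q'); split; try exact: subset_cat.
by rewrite !big_cat /= -e -e' addrACA.
Qed.

Lemma spanN s x : in_span s x -> in_span s (- x).
Proof. by move=> [p [q [sp sq e]]]; exists q, p; split=> //; rewrite -e addKr. Qed.

Lemma spanMn s x n : in_span s x -> in_span s (x *+ n).
Proof.
by move=> s_x; elim: n => [|n IHn]; rewrite ?mulr0n ?mulrS; [apply: span0 | apply: spanD].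
Qed.

Lemma spanMz s x (z : int) : in_span s x -> in_span s (x *~ z).
Proof. by move=> s_x; case: z => n; [|apply: spanN]; apply: spanMn. Qed.

Lemma span_sum s (I : eqType) (r : seq I) (F : I -> V) :
  (forall i, i \in r -> in_span s (F i)) -> in_span s (\sum_(i <- r) F i).
Proof.
move=> sF; rewrite big_seq; apply: (big_ind (in_span s)); last exact: sF.
  exact: span0.
exact: spanD.
Qed.

Lemma pure_span s x : in_span s x -> pure s x.
Proof. by exists 0%N. Qed.

Lemma pureD s x y : pure s x -> pure s y -> pure s (x + y).
Proof.
move=> [n s_x] [m s_y]; exists (n.+1 * m.+1).-1; rewrite prednK ?muln_gt0 //.
rewrite mulrnDl; apply: spanD; first by rewrite mulrnA; apply: spanMn.
by rewrite mulnC mulrnA; apply: spanMn.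
Qed.

Lemma pureN s x : pure s x -> pure s (- x).
Proof. by move=> [n s_x]; exists n; rewrite mulNrn; apply: spanN. Qed.

Lemma pure_root s x n : pure s (x *+ n.+1) -> pure s x.
Proof.
move=> [m s_x]; exists (n.+1 * m.+1).-1; rewrite prednK ?muln_gt0 //.
by rewrite mulrnA.
Qed.

Lemma pure_sub s t x : (forall y, y \in s -> pure t y) -> pure s x -> pure t x.
Proof.
move=> st [n [p [q [sp sq e]]]]; apply: (@pure_root _ _ n).
have t_sum r : {subset r <= s} -> pure t (\sum_(y <- r) y).
  move=> sr; rewrite big_seq; apply: (big_ind (pure t)) => [||y /sr /st //].
    exact/pure_span/span0.
  exact: pureD.
rewrite -[_ *+ _](addrK (\sum_(y <- p) y)) e.
by apply: pureD; [|apply: pureN]; apply: t_sum.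
Qed.

Lemma pure_subgroup s : is_subgroup (pure s).
Proof.
split=> [|x y s_x s_y]; first exact/pure_span/span0.
by apply: pureD => //; apply: pureN.
Qed.

Lemma sum_count (s p : seq V) :
  {subset p <= s} ->
  \sum_(y <- p) y = \sum_(y <- undup s) y *+ count_mem y p.
Proof.
elim: p => [|z p IHp] sp.
  by rewrite big_nil big1 // => y _; rewrite mulr0n.
have s_z : z \in undup s by rewrite mem_undup sp ?mem_head.
rewrite big_cons IHp => [|y p_y]; last by rewrite sp // inE p_y orbT.
rewrite -[z in LHS]mulr1n (bigD1_seq z) ?undup_uniq //=.
rewrite [RHS](bigD1_seq z) ?undup_uniq //=.
rewrite addrA -mulrnDr eqxx; congr (_ + _); apply: eq_bigr => y /negPf.
by rewrite eq_sym => ->.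
Qed.

Definition independent_seq s : Prop := linearly_independent (fun x => x \in s).

(** A relation with a nonzero coefficient at [x] is, after clearing signs, a
    dependence of a positive multiple of [x] on the other elements. *)
Lemma pure_of_relation s (l : seq V) (c : V -> int) x :
  uniq l -> x \in l -> c x != 0 -> {subset l <= x :: s} ->
  \sum_(y <- l) y *~ c y = 0 -> pure s x.
Proof.
move=> l_uniq l_x cx_neq0 l_s; rewrite (bigD1_seq x) //= => /eqP.
rewrite addr_eq0 => /eqP e_x.
have s_cx : in_span s (x *~ c x).
  rewrite e_x; apply: spanN; rewrite -big_filter; apply: span_sum => y.
  rewrite mem_filter => /andP[y_x /l_s]; rewrite inE (negPf y_x) /= => s_y.
  exact/spanMz/span_gen.
case: (c x) cx_neq0 s_cx => [[|n]|n] // _ s_cx; exists n => //.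
by rewrite -[_ *+ _]opprK; apply: spanN.
Qed.

Lemma independent_cons s x :
  independent_seq s -> ~ pure s x -> independent_seq (x :: s).
Proof.
move=> s_free s'_x l c l_uniq l_s sum0.
have cx0 : x \in l -> c x = 0.
  move=> l_x; apply: NNPP => /eqP cx0; apply: s'_x.
  exact: pure_of_relation l_uniq l_x cx0 l_s sum0.
move=> y; have [->|y_x] := eqVneq y x => l_y; first exact: cx0.
apply: (s_free (rem x l) c); rewrite ?rem_uniq //.
- move=> z; rewrite mem_rem_uniq // inE => /andP[z_x /l_s].
  by rewrite inE (negPf z_x).
- have [l_x|l'_x] := boolP (x \in l); last by rewrite rem_id.
  by rewrite (big_rem x) //= cx0 // mulr0z add0r in sum0.
by rewrite mem_rem_uniq // inE y_x.
Qed.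

Lemma basis_pure s : is_basis (fun x => x \in s) -> forall x, pure s x.
Proof.
move=> [s_free s_max] x; apply: NNPP => s'_x; have [] := s'_x.
apply/pure_span/span_gen/(s_max (fun y => y \in x :: s)); rewrite ?mem_head //.
  exact: independent_cons.
by move=> y s_y; rewrite inE s_y orbT.
Qed.

Lemma independent_subseq s :
  exists2 t, independent_seq t & forall x, x \in s -> pure t x.
Proof.
elim: s => [|x s [t t_free t_pure]]; first by exists [::] => // l c _ l0 _ y /l0.
have [t_x|t'_x] := classic (pure t x).
  by exists t => // y; rewrite inE => /predU1P[->|/t_pure].
exists (x :: t); first exact: independent_cons.
move=> y; rewrite inE => /predU1P[->|/t_pure]; first exact/pure_span/span_gen/mem_head.
by apply: pure_sub => z t_z; apply/pure_span/span_gen; rewrite inE t_z orbT.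
Qed.

(** A maximal independent part of [s] is a basis: an element x outside it
    would carry a relation in which its coefficient is positive. *)
Lemma pure_finite_rank s : (forall x, pure s x) -> finite_rank V.
Proof.
move=> s_pure; have [t t_free t_s] := independent_subseq s.
have t_pure x : pure t x by apply: pure_sub (s_pure x).
exists t; split=> // B B_free t_B x B_x.
apply: contraT => t'_x.
have [n [p [q [p_t q_t e]]]] := t_pure x.
(* The relation that puts a multiple of x into the span of t, brought to one
   side. *)
pose c y : int := if y == x then n.+1%:Z else (count_mem y p)%:Z - (count_mem y q)%:Z.
have tx y : y \in undup t -> y != x.
  by rewrite mem_undup; apply: contraTneq => ->.
suff: c x = 0 by rewrite /c eqxx.
apply: (B_free (x :: undup t) c); rewrite ?mem_head //=.
- by rewrite mem_undup t'_x undup_uniq.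
- by move=> y; rewrite inE mem_undup => /predU1P[->|/t_B].
rewrite big_cons {1}/c eqxx -pmulrn.
rewrite (eq_big_seq (fun y => y *+ count_mem y p - y *+ count_mem y q)).
  by rewrite big_split /= sumrN -!sum_count // addrA e subrr.
by move=> y /tx /negPf; rewrite /c => ->; rewrite mulrzBr -!pmulrn.
Qed.

Lemma subgroup0 H : is_subgroup H -> H 0.
Proof. by case. Qed.

Lemma subgroupN H x : is_subgroup H -> H x -> H (- x).
Proof. by move=> [H0 HB] Hx; rewrite -[- x]add0r; apply: HB. Qed.

Lemma subgroupD H x y : is_subgroup H -> H x -> H y -> H (x + y).
Proof. by move=> gH Hx Hy; rewrite -[y]opprK; apply: gH.2 => //; apply: subgroupN. Qed.

Lemma subgroup_sum H (I : eqType) (r : seq I) (F : I -> V) :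
  is_subgroup H -> (forall i, i \in r -> H (F i)) -> H (\sum_(i <- r) F i).
Proof.
move=> gH HF; rewrite big_seq; apply: (big_ind H) => //; first exact: subgroup0.
by move=> x y; apply: subgroupD.
Qed.

Lemma subgroupMn H x n : is_subgroup H -> H x -> H (x *+ n).
Proof.
move=> gH Hx; elim: n => [|n IHn]; rewrite ?mulr0n ?mulrS; first exact: subgroup0.
exact: subgroupD.
Qed.

Lemma map_sub (f : V -> V) (p s : seq V) :
  {subset p <= s} -> {subset map f p <= map f s}.
Proof. by move=> ps _ /mapP[y /ps s_y ->]; apply: map_f. Qed.

(** In a relation that expresses a multiple of an element of [H] by entries of [s],
    the [K]-components of the two sides agree, so the relation persists between
    the projections to [H]. *)
Lemma summand_pure s (f : V -> V) H K :
  torsion_free V -> (forall x, pure s x) -> is_subgroup H -> is_subgroup K ->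
  (forall x, H (f x)) -> (forall x, K (x - f x)) -> (forall x, H x -> K x -> x = 0) ->
  forall x, H x <-> pure (map f s) x.
Proof.
move=> tfV s_pure gH gK Hf Kf HK0 x.
have H_span y : in_span (map f s) y -> H y.
  move=> [p [q [sp sq e]]]; rewrite -[y](addrK (\sum_(z <- p) z)) e.
  by apply: gH.2; apply: subgroup_sum => // z; [move/sq|move/sp] => /mapP[w _ ->].
split=> [Hx|[n /H_span Hnx]].
  have [n [p [q [sp sq e]]]] := s_pure x; exists n.
  exists (map f p), (map f q); split; try exact: map_sub.
  rewrite !big_map; apply/eqP; rewrite -subr_eq0; apply/eqP; apply: HK0.
    apply: gH.2; last exact: subgroup_sum.
    by apply: subgroupD => //; [apply: subgroupMn | apply: subgroup_sum].
  have -> : x *+ n.+1 + \sum_(i <- p) f i - \sum_(i <- q) f i =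
            \sum_(i <- q) (i - f i) - \sum_(i <- p) (i - f i).
    by rewrite !sumrB -e [X in _ = X - _]addrAC addrKA opprK addrAC.
  by apply: gK.2; apply: subgroup_sum.
have Kb : K (x - f x) by [].
have b0 : (x - f x) *+ n.+1 = 0.
  apply: HK0; last exact: subgroupMn.
  by rewrite mulrnBl; apply: gH.2 => //; apply: subgroupMn.
by have /eqP := tfV _ _ (ltn0Sn n) b0; rewrite subr_eq0 => /eqP->.
Qed.

(** Both summands are pure subgroups generated by finite lists, namely by the two
    projections of a basis. *)
Lemma direct_sum_pure H K :
  torsion_free V -> finite_rank V -> is_subgroup H -> is_subgroup K ->
  direct_sum H K ->
  exists h k : seq V, (forall x, H x <-> pure h x) /\ (forall x, K x <-> pure k x).
Proof.
move=> tfV [s /basis_pure s_pure] gH gK [HK HK0].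
have proj x : exists a, H a /\ K (x - a).
  by have [a [b [Ha Kb ->]]] := HK x; exists a; rewrite addrAC subrr add0r.
have [f f_proj] := choice _ proj.
exists (map f s), (map (fun x => x - f x) s); split.
  by apply: (@summand_pure _ _ _ K) => // x; have [] := f_proj x.
apply: (@summand_pure _ _ _ H) => // x; try by have [] := f_proj x.
  by rewrite subKr; have [] := f_proj x.
by move=> Kx Hx; apply: HK0.
Qed.

End Spans.

(** * The index set is Sigma-3 *)

(** The index of a program that sums the list [s] with the operation of index
    [e], so that statements about finite sums become statements about [phi]. *)
Definition sum_num (e z : nat) (s : seq nat) : nat :=
  foldr (fun x k => comp_num e (pair_num (const_num x) k)) (const_num z) s.

Definition sums_to (e z : nat) (s : seq nat) (w : nat) : Prop :=
  phi (sum_num e z s) 0 w.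

(** A triple (n, (p, q)) encodes the relation (n+1) x + sum p = sum q that
    witnesses that x is in a pure subgroup. *)
Definition relation_over (h : seq nat) (t : nat * (seq nat * seq nat)) : bool :=
  all (fun x => x \in h) t.2.1 && all (fun x => x \in h) t.2.2.

Definition relation_holds (e z x : nat) (t : nat * (seq nat * seq nat)) : Prop :=
  exists v, sums_to e z (nseq t.1.+1 x ++ t.2.1) v /\ sums_to e z t.2.2 v.

(** As sums have values, the negation of [relation_holds] can again be recognized,
    by finding two different values. *)
Definition relation_fails (e z x : nat) (t : nat * (seq nat * seq nat)) : Prop :=
  exists v : nat * nat,
    sums_to e z (nseq t.1.+1 x ++ t.2.1) v.1 /\ sums_to e z t.2.2 v.2 /\
    v.1 != v.2.

Definition pure_via (e z : nat) (h : seq nat) (x : nat) : Prop :=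
  exists t, relation_over h t /\ relation_holds e z x t.

Definition not_pure_via (e z : nat) (h : seq nat) (x : nat)
  (t : nat * (seq nat * seq nat)) : Prop :=
  ~~ relation_over h t \/ relation_fails e z x t.

(** Bound tuples keep the two quantifier blocks single, so that each law has
    the shape for all - there is. *)
Definition group_laws (e z : nat) : Prop :=
  [/\ forall u : nat * nat, exists w, phi2 e u.1 u.2 w /\ phi2 e u.2 u.1 w,
      forall u : nat * (nat * nat), exists w : nat * (nat * nat),
        (phi2 e u.1 u.2.1 w.1 /\ phi2 e w.1 u.2.2 w.2.2) /\
        (phi2 e u.2.1 u.2.2 w.2.1 /\ phi2 e u.1 w.2.1 w.2.2),
      forall u, phi2 e z u u &
      forall u, exists v, phi2 e v u z].

Definition torsion_free_law (e z : nat) : Prop :=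
  forall u : nat * nat,
    u.2 == z \/ exists w, sums_to e z (nseq u.1.+1 u.2) w /\ w != z.

Definition splitting_laws (e z : nat) (h k : seq nat) : Prop :=
  [/\ forall x, exists u : nat * nat,
        phi2 e u.1 u.2 x /\ (pure_via e z h u.1 /\ pure_via e z k u.2),
      forall u : nat * ((nat * (seq nat * seq nat)) * (nat * (seq nat * seq nat))),
        u.1 == z \/ (not_pure_via e z h u.1 u.2.1 \/ not_pure_via e z k u.1 u.2.2) &
      has (fun x => x != z) h && has (fun x => x != z) k].

Definition split_tfgroup (e : nat) (d : nat * (seq nat * seq nat)) : Prop :=
  group_laws e d.1 /\ torsion_free_law e d.1 /\ splitting_laws e d.1 d.2.1 d.2.2.

Lemma calc_sum_num {A : Type} {cA : coded A}
  (e z : A -> nat) (s : A -> seq nat) :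
  calc e -> calc z -> calc s -> calc (fun a => sum_num (e a) (z a) (s a)).
Proof.
move=> ce cz cs.
apply: (calc_foldr (g := fun a x k => comp_num (e a) (pair_num (const_num x) k))) => //.
  apply: calc_comp_num; first by apply: (calc_comp ce); calc.
  by apply: calc_pair_num; calc; apply: calc_const_num; calc.
by apply: calc_const_num.
Qed.

Lemma semidec_phi2 {A : Type} {cA : coded A}
  (e x y z : A -> nat) :
  calc e -> calc x -> calc y -> calc z ->
  semidec (fun a => phi2 (e a) (x a) (y a) (z a)).
Proof. by move=> ce cx cy cz; apply: semidec_phi => //; calc. Qed.

Lemma semidec_sums_to {A : Type} {cA : coded A}
  (e z w : A -> nat) (s : A -> seq nat) :
  calc e -> calc z -> calc s -> calc w ->
  semidec (fun a => sums_to (e a) (z a) (s a) (w a)).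
Proof.
by move=> ce cz cs cw; apply: semidec_phi; calc; apply: calc_sum_num.
Qed.

Lemma semidec_pure_via {A : Type} {cA : coded A}
  (e z x : A -> nat) (h : A -> seq nat) :
  calc e -> calc z -> calc h -> calc x ->
  semidec (fun a => pure_via (e a) (z a) (h a) (x a)).
Proof.
move=> ce cz ch cx.
apply: (semidec_ex (P := fun a t =>
  relation_over (h a) t /\ relation_holds (e a) (z a) (x a) t)).
apply: semidec_and.
  by apply: semidec_calc; rewrite /relation_over; calc; apply: (calc_comp ch); calc.
apply: (semidec_ex (P := fun b v =>
  sums_to (e b.1) (z b.1) (nseq b.2.1.+1 (x b.1) ++ b.2.2.1) v /\
  sums_to (e b.1) (z b.1) b.2.2.2 v)).
by apply: semidec_and; apply: semidec_sums_to; calc;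
  first [apply: (calc_comp ce) | apply: (calc_comp cz) | apply: (calc_comp cx)]; calc.
Qed.

Lemma semidec_not_pure_via {A : Type} {cA : coded A}
  (e z x : A -> nat) (h : A -> seq nat)
  (t : A -> nat * (seq nat * seq nat)) :
  calc e -> calc z -> calc h -> calc x -> calc t ->
  semidec (fun a => not_pure_via (e a) (z a) (h a) (x a) (t a)).
Proof.
move=> ce cz ch cx ct.
apply: semidec_or.
  apply: semidec_calc; rewrite /relation_over; calc; apply: (calc_comp ch); calc.
apply: (semidec_ex (P := fun a v =>
  sums_to (e a) (z a) (nseq (t a).1.+1 (x a) ++ (t a).2.1) v.1 /\
  (sums_to (e a) (z a) (t a).2.2 v.2 /\ v.1 != v.2))).
apply: semidec_and; [|apply: semidec_and; last by apply: semidec_calc; calc];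
 by apply: semidec_sums_to; calc;
  first [apply: (calc_comp ce) | apply: (calc_comp cz)
        | apply: (calc_comp cx) | apply: (calc_comp ct)]; calc.
Qed.

Lemma pi2_split_tfgroup :
  pi2 (fun q : nat * (nat * (seq nat * seq nat)) => split_tfgroup q.1 q.2).
Proof.
apply: pi2_and; [|apply: pi2_and].
- apply: (pi2_iff (P := fun q : nat * (nat * (seq nat * seq nat)) =>
    (forall u : nat * nat, exists w, phi2 q.1 u.1 u.2 w /\ phi2 q.1 u.2 u.1 w) /\
    ((forall u : nat * (nat * nat), exists w : nat * (nat * nat),
        (phi2 q.1 u.1 u.2.1 w.1 /\ phi2 q.1 w.1 u.2.2 w.2.2) /\
        (phi2 q.1 u.2.1 u.2.2 w.2.1 /\ phi2 q.1 u.1 w.2.1 w.2.2)) /\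
     ((forall u, phi2 q.1 q.2.1 u u) /\
      (forall u, exists v, phi2 q.1 v u q.2.1))))).
    by move=> q; split=> [[? [? []]]|[]].
  apply: pi2_and; [|apply: pi2_and; [|apply: pi2_and]];
    apply: pi2_all; apply: pi2_semidec.
  + apply: (semidec_ex (P := fun q w =>
      phi2 q.1.1 q.2.1 q.2.2 w /\ phi2 q.1.1 q.2.2 q.2.1 w)).
    by apply: semidec_and; apply: semidec_phi2; calc.
  + apply: (semidec_ex (P := fun q w => 
        (phi2 q.1.1 q.2.1 q.2.2.1 w.1 /\ phi2 q.1.1 w.1 q.2.2.2 w.2.2) /\
        (phi2 q.1.1 q.2.2.1 q.2.2.2 w.2.1 /\ phi2 q.1.1 q.2.1 w.2.1 w.2.2))).
    by apply: semidec_and; apply: semidec_and; apply: semidec_phi2; calc.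
  + by apply: semidec_phi2; calc.
  + apply: (semidec_ex (P := fun q v => phi2 q.1.1 v q.2 q.1.2.1)).
    by apply: semidec_phi2; calc.
- apply: pi2_all; apply: pi2_semidec; apply: semidec_or.
    by apply: semidec_calc; calc.
  apply: (semidec_ex (P := fun q w =>
    sums_to q.1.1 q.1.2.1 (nseq q.2.1.+1 q.2.2) w /\ w != q.1.2.1)).
  by apply: semidec_and; [apply: semidec_sums_to | apply: semidec_calc]; calc.
apply: (pi2_iff (P := fun q : nat * (nat * (seq nat * seq nat)) =>
    (forall x, exists u : nat * nat,
        phi2 q.1 u.1 u.2 x /\
        (pure_via q.1 q.2.1 q.2.2.1 u.1 /\ pure_via q.1 q.2.1 q.2.2.2 u.2)) /\
    ((forall u : nat * ((nat * (seq nat * seq nat)) * (nat * (seq nat * seq nat))),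
        u.1 == q.2.1 \/ (not_pure_via q.1 q.2.1 q.2.2.1 u.1 u.2.1 \/
          not_pure_via q.1 q.2.1 q.2.2.2 u.1 u.2.2)) /\
     has (fun x => x != q.2.1) q.2.2.1 && has (fun x => x != q.2.1) q.2.2.2))).
  by move=> q; split=> [[? []]|[]].
apply: pi2_and; [|apply: pi2_and].
- apply: pi2_all; apply: pi2_semidec.
  apply: (semidec_ex (P := fun q u => phi2 q.1.1 u.1 u.2 q.2 /\
    (pure_via q.1.1 q.1.2.1 q.1.2.2.1 u.1 /\ pure_via q.1.1 q.1.2.1 q.1.2.2.2 u.2))).
  apply: semidec_and; first by apply: semidec_phi2; calc.
  by apply: semidec_and; apply: semidec_pure_via; calc.
- apply: pi2_all; apply: pi2_semidec; apply: semidec_or.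
    by apply: semidec_calc; calc.
  by apply: semidec_or; apply: semidec_not_pure_via; calc.
by apply/pi2_semidec/semidec_calc; calc.
Qed.

Section Presented.

Local Open Scope ring_scope.
Import GRing.Theory.

Variables (e : nat) (G : nat_abgroup).
Hypothesis eG : computable_index e G.

Let z : nat := (0%R : domain G).

Lemma phi2_index (x y w : domain G) : phi2 e x y w <-> w = x + y.
Proof.
split=> [xy_w|->]; last exact: eG.
exact: phi_det xy_w (eG x y).
Qed.

Lemma sums_to_index (s : seq (domain G)) (w : domain G) :
  sums_to e z s w <-> w = \sum_(x <- s) x.
Proof.
rewrite /sums_to; elim: s w => [|x s IHs] w.
  by rewrite big_nil; apply: phi_const.
rewrite big_cons /= phi_comp.
split=> [[p /phi_pair[a [b [/phi_const -> /IHs -> ->]]]]|->].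
  by move/phi2_index.
exists (pair_code x (\sum_(y <- s) y)%R); last exact/phi2_index.
by apply/phi_pair; exists x, (\sum_(y <- s) y); split=> //; [apply/phi_const | apply/IHs].
Qed.

Lemma sum_nseq_cat (n : nat) (x : domain G) (p : seq (domain G)) :
  \sum_(y <- nseq n x ++ p) y = x *+ n + \sum_(y <- p) y.
Proof. by rewrite big_cat big_nseq -Monoid.iteropE. Qed.

Lemma relation_overP (h : seq (domain G)) t :
  relation_over h t <-> {subset t.2.1 <= h} /\ {subset t.2.2 <= h}.
Proof. by split=> [/andP[/allP ? /allP ?]|[? ?]] //; apply/andP; split; apply/allP. Qed.

Lemma pure_via_index (h : seq (domain G)) (x : domain G) :
  pure_via e z h x <-> pure h x.
Proof.
split=> [[[n [p q]] [/relation_overP[/= sp sq]]]|].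
  move=> [v [/sums_to_index v1 /sums_to_index v2]].
  by exists n, p, q; split=> //; rewrite -sum_nseq_cat -v1 v2.
move=> [n [p [q [sp sq e_x]]]]; exists (n, (p, q)); split; first exact/relation_overP.
by exists (\sum_(y <- q) y); split; apply/sums_to_index; rewrite ?sum_nseq_cat.
Qed.

Lemma not_pure_via_index (h : seq (domain G)) (x : domain G) :
  (forall t, not_pure_via e z h x t) <-> ~ pure h x.
Proof.
split=> [not_via /pure_via_index[t [h_t [v [/sums_to_index v1 /sums_to_index v2]]]]|].
  have [|[[w1 w2] [/sums_to_index /= e1 [/sums_to_index /= e2 /eqP[]]]]] := not_via t.
    by rewrite h_t.
  by rewrite e1 e2 -v1.
move=> h'_x t; have [h_t|] := boolP (relation_over h t); [right | by left].
exists (\sum_(y <- nseq t.1.+1 x ++ t.2.1) (y : domain G),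
        \sum_(y <- t.2.2) (y : domain G)).
do ![split; first exact/sums_to_index]; apply/eqP => /= e_t; apply: h'_x.
apply/pure_via_index; exists t; split=> //.
by eexists; split; apply/sums_to_index.
Qed.

Lemma torsion_free_lawP : torsion_free_law e z <-> torsion_free (domain G).
Proof.
split=> [tf x [|n] // _ nx0 | tf [n x]].
  have [/eqP //|[w [/sums_to_index w_x /eqP[]]]] := tf (n, x).
  by rewrite w_x -[nseq _ _]cats0 sum_nseq_cat big_nil addr0 nx0.
have [->|x_neq0] := eqVneq (x : domain G) 0; [by left | right].
exists (\sum_(y <- nseq n.+1 x) (y : domain G)); split; first exact/sums_to_index.
rewrite -[nseq _ _]cats0 sum_nseq_cat big_nil addr0.
by apply: contra_neq x_neq0; apply: tf.
Qed.

(** The lists of [splitting_laws] generate the two summands up to multiples, and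
    together they generate the group up to multiples, which yields finite rank. *)
Lemma splitting_lawsP : torsion_free (domain G) ->
  (exists h k, splitting_laws e z h k) <->
  finite_rank (domain G) /\ decomposable (domain G).
Proof.
move=> tfG; split=> [[h [k [span_hk indep /andP[h_neq0 k_neq0]]]]|[frG [H [K]]]].
  have span x : exists a b,
      [/\ pure (h : seq (domain G)) a, pure (k : seq (domain G)) b & x = a + b].
    have [[a b] [/phi2_index /= -> [/pure_via_index ha /pure_via_index kb]]] := span_hk x.
    by exists a, b.
  have nontriv (s : seq (domain G)) : has (fun x => x != z) s -> nontrivial (pure s).
    by case/hasP=> x s_x /eqP x_neq0; exists x => //; apply/pure_span/span_gen.
  split.
    apply: (@pure_finite_rank _ (h ++ k : seq (domain G))) => x.
    have [a [b [ha kb ->]]] := span x; apply: pureD; [move: ha | move: kb];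
      by apply: pure_sub => y s_y; apply/pure_span/span_gen; rewrite mem_cat s_y ?orbT.
  exists (pure (h : seq (domain G))), (pure (k : seq (domain G))).
  split; [by split; [apply: pure_subgroup | apply: nontriv]
         | by split; [apply: pure_subgroup | apply: nontriv] |].
  split=> // x hx kx; apply: NNPP => x_neq0.
  have [t ht] : exists t, ~ not_pure_via e z h x t.
    by apply: not_all_ex_not => /(iffLR (not_pure_via_index h x)); apply.
  have [t' kt'] : exists t, ~ not_pure_via e z k x t.
    by apply: not_all_ex_not => /(iffLR (not_pure_via_index k x)); apply.
  by have [/eqP|[]] := indep (x, (t, t')).
case=> [[gH ntH] [gK ntK] HK].
have [h [k [Hh Kk]]] := direct_sum_pure tfG frG gH gK HK; have [span HK0] := HK.
have nontriv (s : seq (domain G)) (L : domain G -> Prop) :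
    (forall x, L x <-> pure s x) -> nontrivial L -> has (fun x => x != z) s.
  move=> Ls [x /Ls [n [p [q [sp sq e_x]]]]]; apply: contra_notT => /hasPn s0.
  have sum0 (r : seq (domain G)) : {subset r <= s} -> \sum_(y <- r) y = 0.
    by move=> rs; rewrite big_seq big1 // => y /rs /s0; rewrite negbK => /eqP.
  by apply: (tfG _ n.+1) => //; rewrite !sum0 // addr0 in e_x.
exists h, k; split; last by rewrite (nontriv _ H) // (nontriv _ K).
  move=> x; have [a [b [/Hh ha /Kk kb ->]]] := span x; exists (a, b).
  by split; [apply/phi2_index | split; apply/pure_via_index].
case=> x [t t']; have [->|x_neq0] := eqVneq (x : domain G) 0; [by left | right].
have [hx|h'x] := classic (pure h (x : domain G)).
  right; apply: (iffRL (not_pure_via_index k x)) => kx.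
  by case/eqP: x_neq0; apply: HK0; [apply/Hh | apply/Kk].
by left; apply: (iffRL (not_pure_via_index h x)).
Qed.

End Presented.

Lemma group_lawsP (e z : nat) :
  group_laws e z <-> exists2 G, computable_index e G & z = (0%R : domain G).
Proof.
split=> [[total assoc zero inv]|[G eG ->]]; last first.
  have phiG x y : phi2 e x y (nat_add G x y) by [].
  split.
  - by move=> u; exists (nat_add G u.1 u.2); split=> //; rewrite nat_addC.
  - move=> [u [v w]] /=.
    exists (nat_add G u v, (nat_add G v w, nat_add G u (nat_add G v w))) => /=.
    by do !split=> //; rewrite nat_addA.
  - by move=> u; have := phiG (nat_zero G) u; rewrite nat_add0.
  - by move=> u; exists (nat_opp G u); have := phiG (nat_opp G u) u; rewrite nat_addN.
have [add add_phi] : exists add : nat -> nat -> nat, forall x y, phi2 e x y (add x y).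
  have [f f_phi] := choice _ total.
  by exists (fun x y => f (x, y)) => x y; have [] := f_phi (x, y).
have [opp opp_phi] := choice _ inv.
have addE x y w : phi2 e x y w -> add x y = w by apply: phi_det; apply: add_phi.
have addA : associative add.
  move=> x y w; have [[a [b c]] []] := assoc (x, (y, w)).
  by move=> [/addE <- /addE /= <-] [/addE <- /addE /= <-].
have addC : commutative add.
  by move=> x y; have [w [/addE -> /addE ->]] := total (x, y).
have add0 : left_id z add by move=> x; apply: addE.
have addN : left_inverse z opp add by move=> x; apply: addE.
by exists (NatAbGroup addA addC add0 addN).
Qed.

Lemma split_tfgroupP (e : nat) :
  (exists d, split_tfgroup e d) <->
  exists G : nat_abgroup,
    [/\ computable_index e G, torsion_free (domain G),
        finite_rank (domain G) & decomposable (domain G)].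
Proof.
split=> [[[z [h k]] [/group_lawsP[G eG /= ->] []]]|[G [eG tfG frG dG]]].
  move=> /(torsion_free_lawP eG) tfG split_hk; exists G.
  by have [] : finite_rank (domain G) /\ decomposable (domain G)
    by apply/(splitting_lawsP eG tfG); exists h, k.
have [h [k split_hk]] := iffRL (splitting_lawsP eG tfG) (conj frG dG).
exists ((0%R : domain G) : nat, (h, k)); split; first by apply/group_lawsP; exists G.
by split=> //; apply/torsion_free_lawP.
Qed.

(** * Sums of factorials *)

Lemma seq_max (s : seq nat) :
  s != [::] -> exists2 M, M \in s & forall x, x \in s -> x <= M.
Proof.
elim: s => // x s IHs _; have [->|/IHs[M s_M maxM]] := eqVneq s [::].
  by exists x; rewrite ?mem_head // => y; rewrite inE => /eqP->.
exists (maxn x M) => [|y].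
  by rewrite inE; case: leqP; rewrite ?eqxx // s_M orbT.
by rewrite inE leq_max => /predU1P[->|/maxM->]; rewrite ?leqnn ?orbT.
Qed.

(** If M were absent from [q], the right side would be at most
    (size q) (M-1)!, which is less than M! because [p] is not empty. *)
Lemma factorial_sum_max (p q : seq nat) (M : nat) :
  size p + size q <= M -> M \in p -> (forall x, x \in q -> x <= M) ->
  \sum_(x <- p) x`! = \sum_(x <- q) x`! -> M \in q.
Proof.
move=> le_M p_M q_M; apply: contra_eqT => q'_M.
have M_gt0 : 0 < M by case: p p_M le_M => //= *; lia.
have le_p : M`! <= \sum_(x <- p) x`! by rewrite (big_rem M) //= leq_addr.
have le_q : \sum_(x <- q) x`! <= size q * (M.-1)`!.
  rewrite -sum1_size big_distrl /= big_seq [leqRHS]big_seq leq_sum // => x q_x.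
  rewrite mul1n; apply: leq_fact; rewrite -ltnS prednK // ltn_neqAle q_M // andbT.
  by apply: contraNneq q'_M => <-.
rewrite neq_ltn; apply/orP; right.
apply: leq_ltn_trans le_q (leq_trans _ le_p).
rewrite -[in ltnRHS](prednK M_gt0) factS prednK // ltn_pmul2r ?fact_gt0 //.
by case: p p_M le_M {le_p} => //= *; lia.
Qed.

(** The largest entry, if it is at least [S], occurs on both sides and can be
    removed from both. *)
Lemma factorial_sum_count (p q : seq nat) (S : nat) :
  size p + size q <= S -> \sum_(x <- p) x`! = \sum_(x <- q) x`! ->
  forall x, S <= x -> count_mem x p = count_mem x q.
Proof.
have [n] := ubnP (size p + size q); elim: n p q => // n IHn p q lt_n le_S e_pq.
have [|/hasPn no_big x le_Sx] := boolP (has (fun x => S <= x) (p ++ q)); last first.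
  have [p'_x q'_x] : x \notin p /\ x \notin q.
    by apply/andP; rewrite -negb_or -mem_cat; apply/negP => /no_big; rewrite le_Sx.
  by rewrite !(count_memPn _).
move=> /hasP[y pq_y le_Sy].
have [|M pq_M max_M] := @seq_max (p ++ q); first by case: (p ++ q) pq_y.
have le_SM : S <= M := leq_trans le_Sy (max_M y pq_y).
have [p_M q_M] : M \in p /\ M \in q.
  have p_max x : x \in p -> x <= M by move=> p_x; apply: max_M; rewrite mem_cat p_x.
  have q_max x : x \in q -> x <= M by move=> q_x; apply: max_M; rewrite mem_cat q_x orbT.
  move: pq_M; rewrite mem_cat => /orP[p_M|q_M]; split=> //.
    by apply: factorial_sum_max e_pq => //; apply: leq_trans le_SM.
  by apply: factorial_sum_max (esym e_pq) => //; rewrite addnC (leq_trans le_S).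
have size_p := size_rem p_M; have size_q := size_rem q_M.
have p_gt0 : 0 < size p by case: p p_M {IHn lt_n le_S e_pq pq_y pq_M max_M size_p}.
move=> x le_Sx; rewrite (permP (perm_to_rem p_M)) (permP (perm_to_rem q_M)) /=.
congr (_ + _); apply: IHn => //; rewrite ?size_p ?size_q.
- by move: (size p) (size q) lt_n p_gt0 => a b; lia.
- by move: (size p) (size q) le_S => a b; lia.
by move: e_pq; rewrite (big_rem M p_M) /= (big_rem M q_M) /= => /addnI.
Qed.

Lemma sum_eq_count (R : nmodType) (P : pred nat) (F : nat -> R) (p q : seq nat) :
  (forall i, P i -> count_mem i p = count_mem i q) ->
  (\sum_(i <- p | P i) F i = \sum_(i <- q | P i) F i)%R.
Proof.
move=> eq_pq; rewrite -!(big_filter _ P); apply: perm_big; rewrite /perm_eq.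
apply/allP => i _ /=; rewrite !count_filter; apply/eqP.
have [Pi|P'i] := boolP (P i).
  rewrite -!(eq_count (a1 := pred1 i)) ?eq_pq // => j /=;
    by case: eqP => //= ->; rewrite Pi.
by rewrite !(eq_count (a2 := pred0)) ?count_pred0 // => j /=;
  case: eqP => //= ->; apply/negbTE.
Qed.

Lemma factorial_sum_count_inj (P : pred nat) (E : nat -> nat) (p q : seq nat) (S : nat) :
  {in P &, injective E} -> size p + size q <= S ->
  \sum_(i <- p | P i) (E i)`! = \sum_(i <- q | P i) (E i)`! ->
  forall i, P i -> S <= E i -> count_mem i p = count_mem i q.
Proof.
move=> injE le_S e_pq i Pi le_SE.
have countE r : count_mem (E i) (map E (filter P r)) = count_mem i r.
  rewrite count_map count_filter; apply: eq_count => j /=.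
  apply/andP/eqP => [[/eqP e_ji Pj]|->]; last by rewrite eqxx.
  exact: injE.
rewrite -!countE; apply: factorial_sum_count le_SE.
  rewrite !size_map !size_filter (leq_trans _ le_S) //.
  by rewrite leq_add // count_size.
by rewrite !big_map !big_filter.
Qed.

(** * Words modulo killed generators *)

Section Killing.

Variable kill : nat -> nat -> bool.

(** The generators of index 0 and 1 never die: the first one splits off, and the
    second one is the one to whose multiples the dead ones are identified. *)
Definition dies (i t : nat) : bool := (1 < i) && kill i t.

(** The exponent E of the factorial by which generator i is replaced at stage S.
    When i has not died before S, the search returns S, that is, i is treated as
    dying at stage S. The generator of index 1 is 0! times itself. *)
Definition expo (S i : nat) : nat :=
  if i == 1 then 0 else (pair_code i (find (dies i) (iota 0 S))).+1.

Lemma expo_inj (S : nat) : injective (expo S).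
Proof.
move=> i j; rewrite /expo; case: eqP => [->|_]; case: eqP => // _ [].
by move/pair_code_inj => [].
Qed.

Lemma expo_ge (S i : nat) : i != 1 -> ~~ has (dies i) (iota 0 S) -> S <= expo S i.
Proof.
rewrite /expo => /negPf-> /hasNfind->; rewrite size_iota.
by have := pair_code_ge i S; lia.
Qed.

(** The exponent is final as soon as it is below the stage; before that it is at
    least the stage. *)
Lemma expo_stable (S S' i : nat) : S <= S' ->
  expo S' i = expo S i \/ S <= expo S i /\ S <= expo S' i.
Proof.
move=> le_SS'; have [->|i_neq1] := eqVneq i 1; first by left.
have [alive_i|dead_i] := boolP (has (dies i) (iota 0 S)).
  left; rewrite /expo (negPf i_neq1); congr (pair_code i _).+1.
  by rewrite -(subnKC le_SS') iotaD find_cat alive_i.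
right; split; first exact: expo_ge.
rewrite /expo (negPf i_neq1) -(subnKC le_SS') iotaD find_cat (negPf dead_i) size_iota.
by have := pair_code_ge i (S + find (dies i) (iota (0 + S) (S' - S))); lia.
Qed.

Definition killed (i : nat) : Prop := exists S, expo S i < S.

(** The final exponent of a generator that dies (or has index 1). *)
Definition limit (i : nat) : option nat :=
  if excluded_middle_informative (killed i) is left dead_i
  then Some (expo (ex_minn dead_i) i) else None.

Lemma limit_expo (S i : nat) : expo S i < S -> limit i = Some (expo S i).
Proof.
move=> lt_S; rewrite /limit.
case: excluded_middle_informative => [dead_i|[]]; last by exists S.
congr Some; case: ex_minnP => S0 lt_S0 /(_ S lt_S) /expo_stable -/(_ i).
by case=> // -[]; lia.
Qed.

Lemma expo_limit (S i k : nat) : limit i = Some k -> k < S -> expo S i = k.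
Proof.
rewrite /limit; case: excluded_middle_informative => // dead_i.
case: ex_minnP => S0 lt_S0 min_S0 [<-] lt_S.
have [le_S|le_S] := leqP S0 S; first by have [] := expo_stable i le_S; lia.
by have [] := expo_stable i (ltnW le_S); lia.
Qed.

Definition dead (i : nat) : bool := isSome (limit i).
Definition lexpo (i : nat) : nat := odflt 0 (limit i).

Lemma deadP (i : nat) : reflect (killed i) (dead i).
Proof.
by rewrite /dead /limit; case: excluded_middle_informative => k; constructor.
Qed.

Lemma dead1 : dead 1.
Proof. by apply/deadP; exists 1. Qed.

Lemma dead0 : ~~ dead 0.
Proof.
apply/deadP => -[S]; rewrite ltnNge expo_ge //.
by rewrite (eq_has (a2 := pred0)) ?has_pred0.
Qed.

Lemma lexpo_inj : {in dead &, injective lexpo}.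
Proof.
move=> i j; rewrite !unfold_in /dead /lexpo.
case ei: (limit i) => [k|] // _; case ej: (limit j) => [l|] //= _ e_kl.
apply: (@expo_inj k.+1); rewrite (expo_limit ei) // (expo_limit ej) ?e_kl //.
Qed.

(** The value of a sum of generators in which all of them are taken to be multiples
    of the generator of index 1. *)
Definition weight (S : nat) (p : seq nat) : nat := \sum_(i <- p) (expo S i)`!.

Definition same (p q : seq nat) : bool :=
  weight (size p + size q) p == weight (size p + size q) q.

Section Value.

Local Open Scope ring_scope.
Import GRing.Theory.

Definition gen (i : nat) : {poly int} :=
  if dead i then 'X *+ (lexpo i)`! else 'X^i.

Definition value (p : seq nat) : {poly int} := \sum_(i <- p) gen i.

Lemma coef_value (p : seq nat) (i : nat) : ~~ dead i -> (value p)`_i = (count_mem i p)%:R.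
Proof.
move=> alive_i; rewrite /value coef_sum -sum1_count natr_sum [RHS]big_mkcond /=.
have i_neq1 : i != 1%N by apply: contraNneq alive_i => ->; apply: dead1.
apply: eq_bigr => j _; rewrite /gen; case: ifP => dead_j.
  rewrite coefMn coefX (negPf i_neq1) mul0rn.
  by case: eqP alive_i => // <-; rewrite dead_j.
by rewrite coefXn eq_sym; case: eqP.
Qed.

Lemma coef1_value (p : seq nat) :
  (value p)`_1 = (\sum_(i <- p | dead i) (lexpo i)`!)%N%:R.
Proof.
rewrite /value coef_sum natr_sum [RHS]big_mkcond /=.
apply: eq_bigr => j _; rewrite /gen; case: ifP => dead_j.
  by rewrite coefMn coefX eqxx.
by rewrite coefXn; case: eqP dead_j => // <-; rewrite dead1.
Qed.

End Value.

(** Let S be the total length of the words. Both sides say that the words agree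
    on the generators whose exponent at stage S is at least S, and that the sums
    of factorials over the others coincide. *)
Lemma sameP (p q : seq nat) : same p q <-> value p = value q.
Proof.
set S := size p + size q; pose small i := expo S i < S.
have small_dead i : small i -> dead i by move=> ?; apply/deadP; exists S.
have small_lexpo i : small i -> lexpo i = expo S i.
  by move=> /limit_expo; rewrite /lexpo => ->.
have lexpo_small i : dead i -> lexpo i < S -> small i.
  rewrite /dead /lexpo /small; case e_i: (limit i) => [k|] //= _ lt_k.
  by rewrite (expo_limit e_i).
pose agree := (forall i, ~~ small i -> count_mem i p = count_mem i q) /\
  \sum_(i <- p | small i) (expo S i)`! = \sum_(i <- q | small i) (expo S i)`!.
have weightE r : weight S r = \sum_(i <- r | small i) (expo S i)`! +
    \sum_(i <- r | ~~ small i) (expo S i)`!.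
  by rewrite /weight (bigID small).
have split_gen r : value r =
    ('X *+ (\sum_(i <- r | small i) (expo S i)`!) + \sum_(i <- r | ~~ small i) gen i)%R.
  rewrite /value (bigID small) /= -GRing.sumrMnr; congr (_ + _)%R.
  by apply: eq_bigr => i small_i; rewrite /gen small_dead // small_lexpo.
(* The factorials separate the generators of exponent at least S in the test as
   well as in the coefficient of X in the values. *)
have test : same p q <-> agree.
  rewrite /same -/S; split=> [/eqP e_pq|[agree_big agree_small]].
    have agree_big i : ~~ small i -> count_mem i p = count_mem i q.
      rewrite -leqNgt; apply: (@factorial_sum_count_inj predT (expo S)) => //.
      by move=> ? ? _ _; apply: expo_inj.
    split=> //; move: e_pq; rewrite !weightE.
    by rewrite (@sum_eq_count nat _ _ p q agree_big) => /addIn.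
  by rewrite !weightE agree_small (@sum_eq_count nat _ _ p q agree_big).
rewrite test; split=> [[agree_big agree_small]|e_pq].
  by rewrite !split_gen agree_small (sum_eq_count _ agree_big).
have e_dead : \sum_(i <- p | dead i) (lexpo i)`! = \sum_(i <- q | dead i) (lexpo i)`!.
  by apply/eqP; rewrite -(Num.Theory.eqr_nat int) -!coef1_value e_pq.
have agree_big i : ~~ small i -> count_mem i p = count_mem i q.
  move=> big_i; have [dead_i|alive_i] := boolP (dead i).
    apply: (factorial_sum_count_inj lexpo_inj (leqnn _) e_dead) => //.
    by rewrite leqNgt; apply: contra big_i; apply: lexpo_small.
  by apply/eqP; rewrite -(Num.Theory.eqr_nat int) -!coef_value // e_pq.
split=> //; move: (e_pq); rewrite !split_gen (sum_eq_count _ agree_big).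
move/GRing.addIr/(congr1 (fun f : {poly int} => f`_1)%R).
rewrite !coefMn !coefX /= => /eqP.
by rewrite Num.Theory.eqr_nat => /eqP.
Qed.

End Killing.

(** * The group of a killing relation *)

(** The pair (p, q) stands for the difference of the sums of the generators in [p]
    and in [q]. *)
Definition word : Type := seq nat * seq nat.

Definition word_of (u : nat) : word := dec u.

Definition catw (n m : word) : word := (n.1 ++ m.1, n.2 ++ m.2).

Section KilledGroup.

Variable kill : nat -> nat -> bool.

Definition samew (n m : word) : bool := same kill (n.1 ++ m.2) (m.1 ++ n.2).

(** The number [u] is the least name of its element. *)
Definition fresh (u : nat) : bool :=
  all (fun v => ~~ samew (word_of v) (word_of u)) (iota 0 u).

(** The element with the fresh name [u] becomes the number [position u], which
    makes the domain all of the natural numbers. *)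
Definition position (u : nat) : nat := count fresh (iota 0 u).

Section WordValue.

Local Open Scope ring_scope.
Import GRing.Theory.

Definition wvalue (n : word) : {poly int} := value kill n.1 - value kill n.2.

Lemma value_cat (p q : seq nat) : value kill (p ++ q) = value kill p + value kill q.
Proof. exact: big_cat. Qed.

Lemma samewP (n m : word) : samew n m <-> wvalue n = wvalue m.
Proof.
rewrite /samew sameP !value_cat /wvalue; split=> [e|/eqP].
  by apply/eqP; rewrite subr_eq addrAC -e addrK.
by rewrite subr_eq addrAC => /eqP->; rewrite subrK.
Qed.

Lemma wvalue_cat (n m : word) : wvalue (catw n m) = wvalue n + wvalue m.
Proof. by rewrite /wvalue !value_cat opprD addrACA. Qed.

Lemma wvalue_nseq0 (n : nat) : wvalue (nseq n 0, [::]) = n%:R.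
Proof.
rewrite /wvalue /value big_nseq -Monoid.iteropE /gen (negPf (dead0 kill)) big_nil.
by rewrite subr0 expr0.
Qed.

End WordValue.

Lemma samew_refl (n : word) : samew n n.
Proof. exact/samewP. Qed.

Lemma fresh_inj (u v : nat) :
  fresh u -> fresh v -> samew (word_of u) (word_of v) -> u = v.
Proof.
move=> fu fv uv.
have vu : samew (word_of v) (word_of u) by apply/samewP; apply/esym/samewP.
case: (ltngtP u v) => // [lt_uv|lt_vu].
  by have /allP/(_ u) := fv; rewrite mem_iota uv => /(_ lt_uv).
by have /allP/(_ v) := fu; rewrite mem_iota vu => /(_ lt_vu).
Qed.

Lemma fresh_word (n : word) : exists u, fresh u && samew (word_of u) n.
Proof.
have ex_u : exists u, samew (word_of u) n.
  by exists (enc n); rewrite /word_of encK samew_refl.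
case: (ex_minnP ex_u) => u un min_u; exists u; rewrite un andbT.
apply/allP => v; rewrite mem_iota => /andP[_ lt_vu]; apply/negP => vu.
have : u <= v; last by rewrite leqNgt lt_vu.
by apply: min_u; apply/samewP; rewrite (iffLR (samewP _ _) vu); apply/samewP.
Qed.

Lemma positionS (u : nat) : position u.+1 = position u + fresh u.
Proof. by rewrite /position -addn1 iotaD count_cat /= addn0. Qed.

Lemma position_le (u v : nat) : u <= v -> position u <= position v.
Proof. by move=> /subnKC <-; rewrite /position iotaD count_cat leq_addr. Qed.

Lemma position_inj (u v : nat) : fresh u -> fresh v -> position u = position v -> u = v.
Proof.
move=> fu fv e_uv; case: (ltngtP u v) => // /position_le; rewrite positionS ?fu ?fv; lia.
Qed.

(** The multiples of the generator of index 0 give infinitely many classes. *)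
Lemma position_unbounded (k : nat) : exists u, k < position u.
Proof.
have [f f_fresh] := choice _ (fun n => fresh_word (nseq n 0, [::])).
have f_inj : injective f.
  move=> n m e_f.
  have [/andP[_ /samewP fn] /andP[_ /samewP fm]] := (f_fresh n, f_fresh m).
  move: fm; rewrite -e_f fn !wvalue_nseq0 => /(congr1 (fun p : {poly int} => p`_0)%R).
  by rewrite -!polyC_natr !coefC /= => /eqP; rewrite Num.Theory.eqr_nat => /eqP.
pose s := map f (iota 0 k.+1); exists (\max_(u <- s) u).+1.
have s_uniq : uniq s by rewrite map_inj_uniq // iota_uniq.
have -> : k.+1 = size s by rewrite size_map size_iota.
rewrite /position -size_filter; apply: uniq_leq_size s_uniq _ => u s_u.
rewrite mem_filter mem_iota /= add0n ltnS leq_bigmax_seq // andbT.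
by have /mapP[n _ ->] := s_u; have /andP[] := f_fresh n.
Qed.

Lemma fresh_position (k : nat) : exists u, fresh u && (position u == k).
Proof.
case: (ex_minnP (position_unbounded k)) => -[|u] // lt_k min_u.
have [lt_u|le_u] := ltnP k (position u); first by have := min_u u lt_u; rewrite ltnn.
by exists u; move: lt_k; rewrite positionS; case: (fresh u) => /=; lia.
Qed.

Definition name (k : nat) : nat := ex_minn (fresh_position k).

Lemma nameP (k : nat) : fresh (name k) /\ position (name k) = k.
Proof. by rewrite /name; case: ex_minnP => u /andP[fu /eqP]. Qed.

Definition number (n : word) : nat := position (ex_minn (fresh_word n)).

Section Group.

Local Open Scope ring_scope.
Import GRing.Theory.

Definition gval (k : nat) : {poly int} := wvalue (word_of (name k)).

Lemma gval_number (n : word) : gval (number n) = wvalue n.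
Proof.
rewrite /gval /number; case: ex_minnP => u /andP[fu /samewP <-] _.
have [fn e_n] := nameP (position u).
by rewrite (position_inj fn fu e_n).
Qed.

Lemma gval_inj : injective gval.
Proof.
move=> k l e_kl; have [[fk <-] [fl <-]] := (nameP k, nameP l).
by rewrite (fresh_inj fk fl) //; apply/samewP.
Qed.

Definition gadd (k l : nat) : nat := number (catw (word_of (name k)) (word_of (name l))).
Definition gopp (k : nat) : nat :=
  number ((word_of (name k)).2, (word_of (name k)).1).
Definition gzero : nat := number ([::], [::]).

Lemma gvalD (k l : nat) : gval (gadd k l) = gval k + gval l.
Proof. by rewrite gval_number wvalue_cat. Qed.

Lemma gval0 : gval gzero = 0.
Proof. by rewrite gval_number /wvalue subrr. Qed.

Lemma gvalN (k : nat) : gval (gopp k) = - gval k.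
Proof. by rewrite gval_number /wvalue /= opprB. Qed.

Lemma gaddA : associative gadd.
Proof. by move=> k l m; apply: gval_inj; rewrite !gvalD addrA. Qed.

Lemma gaddC : commutative gadd.
Proof. by move=> k l; apply: gval_inj; rewrite !gvalD addrC. Qed.

Lemma gadd0 : left_id gzero gadd.
Proof. by move=> k; apply: gval_inj; rewrite gvalD gval0 add0r. Qed.

Lemma gaddN : left_inverse gzero gopp gadd.
Proof. by move=> k; apply: gval_inj; rewrite gvalD gvalN gval0 addNr. Qed.

Definition killed_group : nat_abgroup := NatAbGroup gaddA gaddC gadd0 gaddN.

Notation G := (domain killed_group).

Fact gval_additive : zmod_morphism (gval : G -> {poly int}).
Proof. by move=> x y; rewrite [LHS]gvalD gvalN. Qed.

HB.instance Definition _ :=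
  GRing.isZmodMorphism.Build G {poly int} (gval : G -> {poly int}) gval_additive.

Definition elt (i : nat) : G := number ([:: i], [::]).

Lemma gval_elt (i : nat) : gval (elt i) = gen kill i.
Proof. by rewrite gval_number /wvalue /value big_seq1 big_nil subr0. Qed.

Lemma killed_group_torsion_free : torsion_free G.
Proof.
move=> x n n_gt0 /(congr1 (gval : G -> _)); rewrite raddfMn raddf0 => /eqP.
rewrite -[_ *+ n]mulr_natr mulf_eq0 -polyC_natr polyC_eq0 Num.Theory.pnatr_eq0.
rewrite (gtn_eqF n_gt0) orbF => /eqP x0; apply: gval_inj.
by rewrite x0 [RHS]raddf0.
Qed.

Lemma killed_group_decomposable : decomposable G.
Proof.
pose H (x : G) := exists c : int, gval x = c%:P.
pose K (x : G) := (gval x)`_0 = 0.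
exists H, K; split; [split | split | split].
- split=> [|x y [c xc] [d yd]]; first by exists 0; rewrite [LHS]raddf0.
  by exists (c - d); rewrite [LHS]raddfB /= xc yd polyCB.
- have e0 : gval (elt 0) = 1 by rewrite gval_elt /gen (negPf (dead0 kill)) expr0.
  exists (elt 0); first by exists 1.
  by move/(congr1 (gval : G -> _)); rewrite e0 raddf0 => /eqP; rewrite oner_eq0.
- split=> [|x y x0 y0]; rewrite /K; first by rewrite [gval _]raddf0 coef0.
  by rewrite [gval _]raddfB coefB x0 y0 subr0.
- have e1 : gval (elt 1) = 'X *+ (lexpo kill 1)`! by rewrite gval_elt /gen dead1.
  exists (elt 1); first by rewrite /K e1 coefMn coefX mul0rn.
  move/(congr1 (gval : G -> _)); rewrite e1 raddf0.
  move/(congr1 (fun p : {poly int} => p`_1)).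
  rewrite coefMn coefX coef0 => /eqP; rewrite Num.Theory.pnatr_eq0.
  by rewrite (gtn_eqF (fact_gt0 _)).
- move=> x; pose c := (gval x)`_0.
  have a_c : gval (elt 0 *~ c : G) = c%:P.
    by rewrite [LHS]raddfMz /= gval_elt /gen (negPf (dead0 kill)) expr0
      -[in RHS](intz c) (rmorph_int polyC).
  exists (elt 0 *~ c), (x - elt 0 *~ c); split.
  + by exists c.
  + by rewrite /K [gval _]raddfB /= coefB a_c coefC subrr.
  + by rewrite addrC subrK.
move=> x [c xc] x0; apply: gval_inj; rewrite [RHS]raddf0 xc.
by move: x0; rewrite /K xc coefC /= => ->.
Qed.

(** A dead generator is a multiple of the generator of index 1, so the live ones
    and that one generate. Conversely the coefficient at a live generator beyond
    the degrees of a basis vanishes on the span of the basis, which therefore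
    contains no positive multiple of that generator. *)
Lemma killed_group_finite_rank :
  finite_rank G <-> exists b, forall i, (b <= i)%N -> dead kill i.
Proof.
split=> [[s /basis_pure s_pure]|[b b_dead]].
  apply: NNPP => no_b.
  (* All elements of the basis have a degree below b. *)
  pose b := (\max_(x <- s) size (gval x))%N.
  have [i [le_bi alive_i]] : exists i, (b <= i)%N /\ ~~ dead kill i.
    apply: NNPP => no_i; apply: no_b; exists b => i le_bi.
    by apply: contraT => alive_i; case: no_i; exists i.
  have s0 x : x \in s -> (gval x)`_i = 0.
    by move=> s_x; apply: nth_default; apply: leq_trans le_bi; apply: leq_bigmax_seq.
  have sum0 (p : seq G) : {subset p <= s} -> (gval (\sum_(x <- p) x : G)%R)`_i = 0.
    move=> ps; rewrite [gval _]raddf_sum coef_sum big_seq big1 // => x /ps.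
    exact: s0.
  have [n [p [q [ps qs]]]] := s_pure (elt i).
  move/(congr1 (fun x : G => (gval x)`_i)).
  rewrite (raddfD (gval : {additive G -> {poly int}})) coefD /= !sum0 // addr0.
  rewrite (raddfMn (gval : {additive G -> {poly int}})) /= coefMn gval_elt.
  rewrite /gen (negPf alive_i).
  by rewrite coefXn eqxx => /eqP; rewrite -mulrnA Num.Theory.pnatr_eq0.
pose s := [seq elt i | i <- iota 0 (maxn b 2)].
apply: (@pure_finite_rank _ s) => x; apply: pure_span.
have s_elt i : in_span s (elt i).
  have [lt_i|le_i] := ltnP i (maxn b 2).
    by apply: span_gen; apply: map_f; rewrite mem_iota.
  have -> : elt i = elt 1 *+ (lexpo kill i)`!.
    apply: gval_inj; rewrite [RHS]raddfMn /= !gval_elt /gen dead1.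
    rewrite b_dead; last by rewrite (leq_trans _ le_i) // leq_maxl.
    have -> : lexpo kill 1 = 0%N by rewrite /lexpo (@limit_expo _ 1 1).
    by rewrite mulr1n.
  by apply: spanMn; apply: span_gen; apply: map_f; rewrite mem_iota leq_max orbT.
have gval_sum (r : seq nat) : gval (\sum_(i <- r) elt i : G)%R = value kill r.
  by rewrite [LHS]raddf_sum; apply: eq_bigr => i _; apply: gval_elt.
pose n := word_of (name x).
have -> : x = \sum_(i <- n.1) elt i - \sum_(i <- n.2) elt i.
  by apply: gval_inj; rewrite [RHS]raddfB /= !gval_sum.
by apply: spanD; [|apply: spanN]; apply: span_sum.
Qed.

End Group.

End KilledGroup.

(** * Uniform computability of the group *)

Section Uniformity.

Context {A : Type} {cA : coded A}.
Variable kill : A -> nat -> nat -> bool.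
Hypothesis calc_kill : calc (fun q : A * (nat * nat) => kill q.1 q.2.1 q.2.2).

Lemma calc_expo :
  calc (fun q : A * (nat * nat) => expo (kill q.1) q.2.1 q.2.2).
Proof.
rewrite /expo /dies.
calc; by apply: (calc_app3 calc_kill); calc.
Qed.

Lemma calc_samew :
  calc (fun q : A * (word * word) => samew (kill q.1) q.2.1 q.2.2).
Proof.
have calc_weight B (cB : coded B) (a : B -> A) (S : B -> nat) (p : B -> seq nat) :
    calc a -> calc S -> calc p -> calc (fun b => weight (kill (a b)) (S b) (p b)).
  move=> ca cS cp.
  apply: (calc_sum (F := fun b i => (expo (kill (a b)) (S b) i)`!)) => //.
  apply/calc_factorial/(calc_app3 (F := fun a => expo (kill a)) calc_expo);
    last exact: calc_snd calc_id.
    exact: calc_comp ca (calc_fst calc_id).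
  exact: calc_comp cS (calc_fst calc_id).
by rewrite /samew /same /word; apply: calc_eq; apply: calc_weight; calc.
Qed.

Lemma calc_fresh : calc (fun q : A * nat => fresh (kill q.1) q.2).
Proof.
rewrite /fresh /word_of /word.
calc; apply: (calc_app3 (F := fun a => samew (kill a)) calc_samew);
  by rewrite /word; calc.
Qed.

Lemma calc_position : calc (fun q : A * nat => position (kill q.1) q.2).
Proof.
apply: (calc_count (P := fun q u => fresh (kill q.1) u)); last by calc.
by apply: (calc_app2 (F := fun a => fresh (kill a)) calc_fresh); calc.
Qed.

Lemma calc_name : calc (fun q : A * nat => name (kill q.1) q.2).
Proof.
apply: (calc_least (P := fun q u =>
  fresh (kill q.1) u && (position (kill q.1) u == q.2))).
- calc.
    by apply: (calc_app2 (F := fun a => fresh (kill a)) calc_fresh); calc.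
  by apply: (calc_app2 (F := fun a => position (kill a)) calc_position); calc.
- by move=> [a k]; have [/= -> ->] := nameP (kill a) k; rewrite eqxx.
move=> [a k] u /=; rewrite /name; case: ex_minnP => v _ min_v lt_uv.
by apply: contraL lt_uv => /min_v; rewrite leqNgt.
Qed.

Lemma calc_number : calc (fun q : A * word => number (kill q.1) q.2).
Proof.
apply: (calc_app2 (F := fun a => position (kill a)) calc_position).
  by rewrite /word; calc.
apply: (calc_least (P := fun (q : A * word) u =>
  fresh (kill q.1) u && samew (kill q.1) (word_of u) q.2)).
- calc.
    by apply: (calc_app2 (F := fun a => fresh (kill a)) calc_fresh); rewrite /word; calc.
  apply: (calc_app3 (F := fun a => samew (kill a)) calc_samew);
    by rewrite /word_of /word; calc.
- by move=> [a n]; case: ex_minnP.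
move=> [a n] u /=; case: ex_minnP => v _ min_v lt_uv.
by apply: contraL lt_uv => /min_v; rewrite leqNgt.
Qed.

Lemma calc_gadd : calc (fun q : A * (nat * nat) => gadd (kill q.1) q.2.1 q.2.2).
Proof.
apply: (calc_app2 (F := fun a => number (kill a)) calc_number); first by calc.
rewrite /catw /word_of /word.
by calc; apply: (calc_app2 (F := fun a => name (kill a)) calc_name); calc.
Qed.

End Uniformity.

(** * Marks of a Sigma-3 predicate *)

(** The operation determines zero and opposites. This lets a property of one group
    with a given index be transferred to any other group with that index. *)
Lemma nat_abgroup_ext (G G' : nat_abgroup) : nat_add G =2 nat_add G' -> G = G'.
Proof.
case: G G' => [add z opp addA addC add0 addN].
case=> [add' z' opp' addA' addC' add0' addN'] /= e_add.
have {}e_add : add = add'.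
  by do 2![apply: functional_extensionality => ?]; apply: e_add.
case: _ / e_add in addA' addC' add0' addN' *.
have e_z : z = z' by rewrite -[z]add0' addC add0.
case: _ / e_z in add0' addN' *.
have e_opp : opp = opp'.
  apply: functional_extensionality => x.
  by rewrite -[opp x]add0 -(addN' x) -addA [add x _]addC addN addC add0.
case: _ / e_opp in addN' *.
by congr NatAbGroup; apply: proof_irrelevance.
Qed.

Lemma dead_dies (kill : nat -> nat -> bool) (i : nat) :
  1 < i -> dead kill i <-> exists t, kill i t.
Proof.
move=> i_gt1; have i_neq1 : i != 1 by lia.
split=> [/deadP[S lt_S]|[t kill_t]].
  have [/hasP[t _ /andP[_ kill_t]]|] := boolP (has (dies kill i) (iota 0 S)).
    by exists t.
  by move/(expo_ge i_neq1); rewrite leqNgt lt_S.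
have has_t : has (dies kill i) (iota 0 t.+1).
  apply/hasP; exists t; first by rewrite mem_iota add0n ltnSn.
  by rewrite /dies i_gt1.
set l := expo kill t.+1 i; apply/deadP; exists (maxn t.+1 l.+1).
suff -> : expo kill (maxn t.+1 l.+1) i = l by rewrite leq_max ltnSn orbT.
rewrite /l /expo (negPf i_neq1); congr (pair_code i _).+1.
by rewrite -(subnKC (leq_maxl t.+1 _)) iotaD find_cat has_t.
Qed.

Section Marks.

Variable R : nat -> nat -> nat -> bool.

(** The number of initial [y] that have a witness below [u], cut off at [u] to keep
    it computable. It is unbounded in [u] exactly when every [y] has a witness. *)
Definition depth (n u : nat) : nat :=
  find (fun y => ~~ has (fun z => R n y z) (iota 0 u)) (iota 0 u).

(** A monotone sequence of numbers is unbounded exactly when it grows infinitely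
    often. *)
Definition fires (n u : nat) : bool := depth n u < depth n u.+1.

(** Stages at which nothing fires carry their own number, so that they do not
    contribute to a finite inferior limit. *)
Definition mark (s : nat) : nat :=
  if fires (Cantor.of_nat s).1 (Cantor.of_nat s).2 then (Cantor.of_nat s).1 else s.

Definition outbid (i t : nat) : bool := (i < t) && (mark t <= mark i).

Lemma depthP (n u l : nat) :
  l <= depth n u <-> l <= u /\ forall y, y < l -> exists2 z, z < u & R n y z.
Proof.
split=> [le_l|[le_lu wit]].
  have le_lu : l <= u.
    by apply: leq_trans le_l _; rewrite -[leqRHS](size_iota 0) find_size.
  split=> // y lt_yl; have lt_yu := leq_trans lt_yl le_lu.
  have := before_find 0 (leq_trans lt_yl le_l); rewrite nth_iota // add0n => /negbFE.
  by case/hasP=> z; rewrite mem_iota => /andP[_ lt_zu] Rz; exists z.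
rewrite leqNgt; apply/negP => lt_l; have lt_u := leq_trans lt_l le_lu.
have := wit _ lt_l => -[z lt_zu Rz].
have fails : has (fun y => ~~ has (fun z => R n y z) (iota 0 u)) (iota 0 u).
  by rewrite has_find size_iota.
have := nth_find 0 fails; rewrite -/(depth n u) nth_iota // add0n /= => /hasPn no_z.
by have := no_z z; rewrite mem_iota Rz => /(_ lt_zu).
Qed.

Lemma depth_le (n u v : nat) : u <= v -> depth n u <= depth n v.
Proof.
move=> le_uv; have [le_u wit] := iffLR (depthP n u (depth n u)) (leqnn _).
apply/depthP; split=> [|y /wit[z lt_z Rz]]; first exact: leq_trans le_uv.
by exists z => //; apply: leq_trans le_uv.
Qed.

Lemma fires_infinitely (n m : nat) :
  (forall y, exists z, R n y z) -> exists2 u, m <= u & fires n u.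
Proof.
move=> wit; apply: NNPP => no_u.
have depth_m u : m <= u -> depth n u <= depth n m.
  elim: u => [|u IHu]; first by rewrite leqn0 => /eqP->.
  rewrite leq_eqVlt => /predU1P[->|le_mu] //; apply: leq_trans (IHu le_mu).
  by rewrite leqNgt; apply/negP => fire_u; apply: no_u; exists u.
have [u wit_u] : exists u, forall y, y < (depth n m).+1 -> exists2 z, z < u & R n y z.
  elim: (depth n m).+1 => [|l [u wit_u]]; first by exists 0.
  have [z Rz] := wit l; exists (maxn u z.+1) => y.
  rewrite ltnS leq_eqVlt => /predU1P[->|/wit_u[z' lt_z' Rz']].
    by exists z; rewrite // leq_max ltnSn orbT.
  by exists z'; rewrite // leq_max lt_z'.
have := depth_m (maxn m (maxn u (depth n m).+1)) (leq_maxl _ _).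
rewrite leqNgt => /negP[]; apply/depthP; split; first by rewrite !leq_max ltnSn !orbT.
move=> y /wit_u[z lt_z Rz]; exists z => //; apply: leq_trans lt_z _.
by rewrite leq_max leq_maxl orbT.
Qed.

Lemma fires_finitely (n : nat) :
  ~ (forall y, exists z, R n y z) -> exists m, forall u, m <= u -> ~~ fires n u.
Proof.
move=> /not_all_ex_not[y no_z].
have depth_y u : depth n u <= y.
  rewrite leqNgt; apply/negP => /depthP[_ /(_ y (ltnSn y))[z _ Rz]].
  by apply: no_z; exists z.
have [k] := ubnP (y - depth n 0); elim: k (0) => // k IHk m lt_k.
have [fin_m|] := classic (forall u, m <= u -> ~~ fires n u); first by exists m.
move=> nofin; have [u nu] := not_all_ex_not _ _ nofin.
have [le_mu /negP/negPn fire_u] := imply_to_and _ _ nu.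
apply: (IHk u.+1); have := depth_le n le_mu; have := depth_y u.+1.
by rewrite /fires in fire_u; lia.
Qed.

(** If no [n] fires infinitely often, every value is the mark of finitely many
    stages. *)
Lemma mark_small (v : nat) :
  (forall n, ~ forall y, exists z, R n y z) ->
  exists m, forall t, m <= t -> v < mark t.
Proof.
move=> none; have [M M_fin] := choice _ (fun n => fires_finitely (none n)).
exists (maxn v (\max_(n < v.+1) \max_(u < M n) pair_code n u)).+1 => t.
rewrite gtn_max => /andP[lt_v lt_t]; rewrite /mark.
case: ifP => // fire_t; rewrite ltnNge; apply/negP; rewrite -ltnS => le_v.
have lt_M : (Cantor.of_nat t).2 < M (Cantor.of_nat t).1.
  by rewrite ltnNge; apply/negP => /M_fin; rewrite fire_t.
have := leq_bigmax (F := fun n : 'I_v.+1 => \max_(u < M n) pair_code n u) (Ordinal le_v).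
have := leq_bigmax (F := fun u : 'I_(M (Cantor.of_nat t).1) =>
  pair_code (Cantor.of_nat t).1 u) (Ordinal lt_M).
rewrite /= {1}/pair_code -surjective_pairing Cantor.cancel_to_of => le1 le2.
by have := leq_ltn_trans (leq_trans le1 le2) lt_t; rewrite ltnn.
Qed.

(** The generators that are never outbid are those whose mark is below all later
    marks; there are finitely many of them exactly when the marks have a finite
    inferior limit. *)
Lemma outbid_cofinite :
  (exists n, forall y, exists z, R n y z) <->
  exists b, forall i, b <= i -> dead outbid i.
Proof.
split=> [[n wit]|[b b_dead]].
  (* The least v which infinitely many marks do not exceed: eventually all marks
     are at least v, and every generator from there on is outbid. *)
  pose often v := forall m, exists t, m < t /\ mark t <= v.
  have often_n : often n.
    move=> m; have [u le_mu fire_u] := fires_infinitely m.+1 wit.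
    exists (pair_code n u); rewrite /mark pair_codeK fire_u; split=> //.
    by have := pair_code_ge n u; lia.
  have [v [often_v min_v]] : exists v, often v /\ forall w, w < v -> ~ often w.
    elim/ltn_ind: n often_n {wit} => n IHn often_n.
    have [[w [lt_w often_w]]|no_w] := classic (exists w, w < n /\ often w).
      exact: IHn often_w.
    by exists n; split=> // w lt_w often_w; apply: no_w; exists w.
  have [b b_v] : exists b, forall t, b < t -> v <= mark t.
    case: v min_v {often_v} => [|v] min_v; first by exists 0.
    have /not_all_ex_not[b no_t] := min_v v (ltnSn v).
    exists b => t lt_bt; rewrite ltnNge; apply/negP => le_t.
    by apply: no_t; exists t.
  exists (maxn b.+1 2) => i; rewrite geq_max => /andP[lt_bi i_gt1].
  apply/dead_dies => //; have [t [lt_it le_t]] := often_v i.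
  by exists t; rewrite /outbid lt_it (leq_trans le_t) ?b_v.
apply: NNPP => none.
have {}none n : ~ forall y, exists z, R n y z.
  by move=> wit; apply: none; exists n.
pose c := maxn b 2.
suff [i [le_ci alive_i]] : exists i, c <= i /\ forall t, i < t -> mark i < mark t.
  move: le_ci; rewrite geq_max => /andP[/b_dead dead_i i_gt1].
  have [t /andP[/alive_i lt_t]] := iffLR (dead_dies outbid i_gt1) dead_i.
  by rewrite leqNgt lt_t.
(* The last stage from c on that carries the least mark is never outbid. *)
suff lowest w t : c <= t -> mark t = w ->
    exists i, c <= i /\ forall t', i < t' -> mark i < mark t'.
  exact: lowest (leqnn c) erefl.
elim/ltn_ind: w t => w IHw t le_ct mark_t.
have [[t' [le_ct' lt_t']]|no_lower] := classic (exists t', c <= t' /\ mark t' < w).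
  exact: IHw lt_t' t' le_ct' erefl.
have [m m_w] := mark_small w none.
have ex_t : exists t, (c <= t) && (mark t == w) by exists t; rewrite le_ct mark_t /=.
have le_m t' : (c <= t') && (mark t' == w) -> t' <= m.
  case/andP=> _ /eqP mark_t'; rewrite leqNgt; apply/negP => /ltnW/m_w.
  by rewrite mark_t' ltnn.
case: (ex_maxnP ex_t le_m) => i /andP[le_ci /eqP mark_i] max_i.
exists i; split=> // t' lt_it'.
have le_ct' : c <= t' by lia.
rewrite mark_i ltn_neqAle; apply/andP; split.
  apply/eqP => mark_t'; have := max_i t'.
  by rewrite le_ct' -mark_t' eqxx leqNgt lt_it' => /(_ isT).
by rewrite leqNgt; apply/negP => lt_t'; apply: no_lower; exists t'.
Qed.

End Marks.

Section MarkUniformity.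

Variable R : nat -> nat -> nat -> nat -> bool.
Hypothesis calc_R :
  calc (fun q : nat * (nat * (nat * nat)) => R q.1 q.2.1 q.2.2.1 q.2.2.2).

Lemma calc_depth {A : Type} {cA : coded A} (x n u : A -> nat) :
  calc x -> calc n -> calc u -> calc (fun a => depth (R (x a)) (n a) (u a)).
Proof.
move=> cx cn cu.
have calc_R' B (cB : coded B) (f g h k : B -> nat) : calc f -> calc g -> calc h ->
    calc k -> calc (fun b => R (f b) (g b) (h b) (k b)).
  move=> cf cg ch ck.
  exact: calc_comp calc_R (calc_pair cf (calc_pair cg (calc_pair ch ck))).
rewrite /depth; calc; last exact: calc_comp cu (calc_fst calc_id).
by apply: calc_R'; calc; [apply: (calc_comp cx) | apply: (calc_comp cn)]; calc.
Qed.

Lemma calc_mark {A : Type} {cA : coded A} (x s : A -> nat) :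
  calc x -> calc s -> calc (fun a => mark (R (x a)) (s a)).
Proof. by move=> cx cs; rewrite /mark /fires; calc; apply: calc_depth; calc. Qed.

Lemma calc_outbid :
  calc (fun q : nat * (nat * nat) => outbid (R q.1) q.2.1 q.2.2).
Proof. by rewrite /outbid; calc; apply: calc_mark; calc. Qed.

End MarkUniformity.

Theorem theorem5p2 :
  complete Sigma03 (fun e : nat =>
    exists G : nat_abgroup,
      [/\ computable_index e G, torsion_free (domain G),
          finite_rank (domain G) & decomposable (domain G)]).
Proof.
split=> [|B [R /computable_rel4P calc_R B_R]].
  have [S S_calc S_split] := Sigma03_ex pi2_split_tfgroup.
  by exists S => // e; rewrite -split_tfgroupP S_split.
pose add x y :=
  gadd (outbid (R x)) (Cantor.of_nat y).1 (Cantor.of_nat y).2.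
have [g g_comp g_add] :
    exists2 g, computable g & forall x y, phi (g x) y (add x y).
  apply: (calc_smn (f := add)).
  apply: (calc_app3 (F := fun x => gadd (outbid (R x)))); last by calc.
  - exact: (calc_gadd (kill := fun x => outbid (R x)) (calc_outbid calc_R)).
  - by calc.
  - by calc.
exists g => // x.
have g_index : computable_index (g x) (killed_group (outbid (R x))).
  by move=> u v; have := g_add x (pair_code u v); rewrite /add pair_codeK.
rewrite B_R outbid_cofinite -killed_group_finite_rank; split=> [fr|[G [eG _ fr _]]].
  exists (killed_group (outbid (R x))); split=> //.
    exact: killed_group_torsion_free.
  exact: killed_group_decomposable.
rewrite (_ : killed_group _ = G) //; apply: nat_abgroup_ext => u v.
exact: phi_det (g_index u v) (eG u v).
Qed.
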